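(* Let $G$ be a discrete group and let $B$ be any $G$-boundary. Then there is a continuous $G$-equivariant map from the Hamana boundary $\partial_H G$ onto $B$. Consequently $\partial_H G$ is the universal $G$-boundary, i.e. it is $G$-equivariantly homeomorphic to the Furstenberg boundary $\partial_F G$.
   Context: A compact $G$-space is a $G$-boundary if it is minimal (all orbits dense) and strongly proximal (for every probability measure $\nu$ the weak* closure of $G\nu$ contains a point mass). Furstenberg: there is a unique $G$-boundary $\partial_F G$ such that every $G$-boundary is a continuous $G$-equivariant image of $\partial_F G$; this is the Furstenberg boundary. The Hamana boundary $\partial_H G$ is the compact $G$-space with $C(\partial_H G)=I_G(\mathbb{C})$, the $G$-injective envelope (in Hamana's sense) of $\mathbb{C}$ with trivial action, realized inside $\ell^\infty(G)$ (left translation) as the range of a unital positive $G$-equivariant idempotent, with the Choi–Effros product. *)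

(* Defs.v *)
From HB Require Import structures.
From mathcomp Require Import all_boot all_order all_algebra.
From mathcomp Require Import monoid.
From mathcomp Require Import all_classical all_reals all_analysis.
From mathcomp Require Import complex.
Import Order.TTheory GRing.Theory Num.Theory.
Import numFieldTopology.Exports numFieldNormedType.Exports.

Set Implicit Arguments.
Unset Strict Implicit.
Unset Printing Implicit Defensive.

Local Open Scope classical_set_scope.
Local Open Scope ring_scope.

Definition CC (R : realType) : numClosedFieldType := R[i].

Definition compact_Gspace (R : realType) (G : groupType) (X : topologicalType)
    (act : G -> X -> X) : Prop :=
  [/\ [set: X] !=set0, compact [set: X], hausdorff_space X &
    [/\ (forall x, act 1%g x = x),
      (forall s t x, act (s * t)%g x = act s (act t x)) &
      (forall s, continuous (act s))]].

Definition minimal_action (G : groupType) (X : topologicalType)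
    (act : G -> X -> X) : Prop :=
  forall x : X, closure (range (fun s : G => act s x)) = [set: X].

(* Probability (Radon) measures on the compact Hausdorff space X, viewed
   via the Riesz identification as states on C(X) = C(X, R): positive,
   unital, linear functionals on the continuous real functions.  Only the
   values on continuous functions matter. *)
Definition prob_state (R : realType) (X : topologicalType) (nu : (X -> R) -> R)
  : Prop :=
  [/\ (forall (a : R) (f g : X -> R), continuous f -> continuous g ->
         nu (fun x => a * f x + g x) = a * nu f + nu g),
      (forall f : X -> R, continuous f -> (forall x, 0 <= f x) -> 0 <= nu f) &
      nu (fun _ => 1) = 1].

Definition state_act (R : realType) (G : groupType) (X : topologicalType)
    (act : G -> X -> X) (s : G) (nu : (X -> R) -> R) : (X -> R) -> R :=
  fun f => nu (fun x => f (act s x)).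

(* The weak* closure of the orbit G.nu contains the point mass delta_x:
   every basic weak* neighbourhood of delta_x meets G.nu. *)
Definition weakstar_orbit_closure_has_dirac (R : realType) (G : groupType)
    (X : topologicalType) (act : G -> X -> X) (nu : (X -> R) -> R) (x : X)
  : Prop :=
  forall (n : nat) (f : 'I_n -> X -> R), (forall i, continuous (f i)) ->
  forall e : R, 0 < e ->
  exists s : G, forall i, `|state_act act s nu (f i) - f i x| < e.

Definition strongly_proximal (R : realType) (G : groupType)
    (X : topologicalType) (act : G -> X -> X) : Prop :=
  forall nu : (X -> R) -> R, prob_state nu ->
  exists x : X, weakstar_orbit_closure_has_dirac act nu x.

Definition G_boundary (R : realType) (G : groupType) (X : topologicalType)
    (act : G -> X -> X) : Prop :=
  [/\ compact_Gspace R act, minimal_action act & strongly_proximal R act].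

Definition equivariant (G : groupType) (X Y : Type)
    (actX : G -> X -> X) (actY : G -> Y -> Y) (p : X -> Y) : Prop :=
  forall s x, p (actX s x) = actY s (p x).

Definition equivariant_factor (G : groupType) (X Y : topologicalType)
    (actX : G -> X -> X) (actY : G -> Y -> Y) : Prop :=
  exists p : X -> Y, [/\ continuous p, equivariant actX actY p &
                         forall y, exists x, p x = y].

Definition equivariant_homeomorphic (G : groupType) (X Y : topologicalType)
    (actX : G -> X -> X) (actY : G -> Y -> Y) : Prop :=
  exists (p : X -> Y) (q : Y -> X),
    [/\ continuous p, continuous q, cancel p q, cancel q p &
        equivariant actX actY p].

(* A Furstenberg boundary: a G-boundary of which every G-boundary is a
   continuous G-equivariant image (unique up to equivariant homeomorphism
   by Furstenberg's theorem). *)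
Definition Furstenberg_boundary (R : realType) (G : groupType)
    (F : topologicalType) (actF : G -> F -> F) : Prop :=
  G_boundary R actF /\
  forall (B : topologicalType) (actB : G -> B -> B),
    G_boundary R actB -> equivariant_factor actF actB.

(* l^oo(G): bounded complex functions on G (we work with all functions
   G -> C and restrict attention to the bounded ones). *)
Definition bdd (R : realType) (G : Type) (f : G -> CC R) : Prop :=
  exists M : CC R, forall t, `|f t| <= M.

Definition ltrans (R : realType) (G : groupType) (s : G) (f : G -> CC R)
  : G -> CC R := fun t => f (s^-1 * t)%g.

(* A G-projection on l^oo(G): a unital positive G-equivariant linear
   idempotent l^oo(G) -> l^oo(G).  (Positive maps into the commutative
   C*-algebra l^oo(G) are automatically completely positive.) *)
Definition G_projection (R : realType) (G : groupType)
    (phi : (G -> CC R) -> (G -> CC R)) : Prop :=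
  [/\ (forall f, bdd f -> bdd (phi f)),
      phi (fun _ => 1) = (fun _ => 1) &
   [/\
      (forall (a : CC R) f h, bdd f -> bdd h ->
         phi (fun t => a * f t + h t) = (fun t => a * phi f t + phi h t)),
      (forall f, bdd f -> (forall t, 0 <= f t) -> forall t, 0 <= phi f t),
      (forall s f, bdd f -> phi (ltrans s f) = ltrans s (phi f)) &
      (forall f, bdd f -> phi (phi f) = phi f)]].

Definition proj_le (R : realType) (G : groupType)
    (psi phi : (G -> CC R) -> (G -> CC R)) : Prop :=
  forall f, bdd f -> psi (phi f) = psi f /\ phi (psi f) = psi f.

(* A minimal G-projection; its range is (a copy of) the G-injective
   envelope I_G(C) (Hamana). *)
Definition minimal_G_projection (R : realType) (G : groupType)
    (phi : (G -> CC R) -> (G -> CC R)) : Prop :=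
  G_projection phi /\
  forall psi, G_projection psi -> proj_le psi phi ->
    forall f, bdd f -> psi f = phi f.

(* Characters of the commutative C*-algebra I_G(C) = phi(l^oo(G)) with the
   Choi-Effros product a o b = phi(a b).  A character chi of the range is
   encoded as the functional f |-> chi(phi f) on l^oo(G), extended by 0 to
   unbounded functions (so that the encoding is one-to-one). *)
Definition Hamana_character (R : realType) (G : groupType)
    (phi : (G -> CC R) -> (G -> CC R)) (chi : (G -> CC R) -> CC R) : Prop :=
  [/\ (forall f, ~ bdd f -> chi f = 0),
      (forall f, bdd f -> chi f = chi (phi f)),
      (forall (a : CC R) f h, bdd f -> bdd h ->
         chi (fun t => a * f t + h t) = a * chi f + chi h),
      chi (fun _ => 1) = 1 &
      (forall f h, bdd f -> bdd h ->
         chi (phi (fun t => phi f t * phi h t)) = chi (phi f) * chi (phi h))].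

(* The Hamana boundary: the Gelfand spectrum of I_G(C), with the weak*
   topology (pointwise convergence), i.e. the subspace topology inherited
   from the product topology on (G -> C) -> C. *)
Definition Hamana_boundary (R : realType) (G : groupType)
    (phi : (G -> CC R) -> (G -> CC R)) : topologicalType :=
  set_type (Hamana_character phi : set {ptws (G -> CC R) -> CC R}).

(* The G-action on the spectrum dual to left translation:
   (s.chi)(a) = chi(s^-1 . a).  (insubd falls back to chi only if the
   translate is not a character, which never happens when phi is a
   G-projection.) *)
Definition Hamana_act (R : realType) (G : groupType)
    (phi : (G -> CC R) -> (G -> CC R)) (s : G) (chi : Hamana_boundary phi)
  : Hamana_boundary phi :=
  insubd chi (fun f => (val chi : (G -> CC R) -> CC R) (ltrans s^-1 f)).
Arguments Hamana_act {R G} phi s chi.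

(* Main.v *)
(** Unital positive functionals on [l^oo(G)] form a compact right-topological
    semigroup under convolution.  The idea is rigidity: if [nu] is such a
    functional with [nu \o phi = nu], then [phi \o transl nu = phi].  Indeed
    the [w] with [w \o phi = w] and [w * nu = w] form a nonempty compact
    subsemigroup, by Cesaro averaging; an Ellis idempotent [p] in it gives a
    G-projection [phi \o transl p] below [phi], hence equal to [phi], and
    [p * nu = p] then gives the claim.

    Let [x] be a character and [h >= 0] with [x(h) = 0].  Rigidity gives
    [x(transl m h) = x(h) = 0] for every invariant [m], so some translate of
    [h] is small at [m].  Since such [h] separate [x] from closed sets, every
    point mass is a weak* limit of the orbit of every state of the Hamana
    boundary, which is therefore minimal and strongly proximal.

    A point of a boundary [B] turns functions on [B] into elements of
    [l^oo(G)], hence characters into states of [B].  Strong proximality of [B]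
    makes one of them a point mass, minimality makes all of them point masses,
    and this is the map onto [B].  Finally an equivariant continuous self-map
    of a boundary is the identity, so two universal boundaries are
    homeomorphic. *)

Require Import Defs.
From HB Require Import structures.
From mathcomp Require Import all_boot all_order all_algebra.
From mathcomp Require Import monoid.
From mathcomp Require Import all_classical all_reals all_analysis.
From mathcomp Require Import complex ring lra.
Import Order.TTheory GRing.Theory Num.Theory.
Import numFieldTopology.Exports numFieldNormedType.Exports.

Set Implicit Arguments.
Unset Strict Implicit.
Unset Printing Implicit Defensive.

Local Open Scope classical_set_scope.
Local Open Scope ring_scope.

(** * Compactness and separation *)

(** The points meeting a finite list of conditions generate a proper filter, and a cluster point of
    it in [K] lies in every closed [V i]. Most existence proofs below have this shape: encode the
    object by closed conditions, then satisfy finitely many at a time. *)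
Lemma compact_fip (X : topologicalType) (I : eqType) (K : set X)
    (V : I -> set X) :
  compact K -> (forall i, closed (V i)) ->
  (forall s : seq I, exists2 x, K x & {in s, forall i, V i x}) ->
  exists2 x, K x & forall i, V i x.
Proof.
move=> cK clV fip.
pose B (s : seq I) := K `&` [set x | {in s, forall i, V i x}].
pose F := filter_from [set: seq I] B.
have FF : ProperFilter F.
  apply: filter_from_proper.
    apply: filter_from_filter; first by exists [::].
    move=> s t _ _; exists (s ++ t) => // x [Kx xV]; split; split => // i si;
      by apply: xV; rewrite mem_cat si ?orbT.
  by move=> s _; have [x Kx xV] := fip s; exists x.
have FK : F K by exists [::] => // x [].
have [x [Kx cx]] := cK F FF FK.
exists x => // i; apply: (clV i) => U Ux; apply: cx => //.
by exists [:: i] => // y [_]; apply; rewrite mem_head.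
Qed.

Lemma continuous_ptws (X : topologicalType) (I : Type) (V : topologicalType)
    (g : X -> {ptws I -> V}) :
  (forall i, continuous (fun x => g x i)) -> continuous g.
Proof.
move=> cg x; apply/cvg_sup => i U [W [[A oA <-] Ax AU]].
apply: (filterS AU); apply: (cg i x); exact: open_nbhs_nbhs.
Qed.

Lemma ptws_eval_continuous (I : Type) (V : topologicalType) (i : I) :
  continuous (fun f : {ptws I -> V} => f i).
Proof. exact: (@proj_continuous {classic I} (fun _ => V) i). Qed.

Lemma ptws_hausdorff (I : Type) (V : topologicalType) :
  hausdorff_space V -> hausdorff_space {ptws I -> V}.
Proof. by move=> hV; exact: (@hausdorff_product {classic I} (fun _ => V)). Qed.

Lemma ptws_compact (I : Type) (V : topologicalType) (A : I -> set V) :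
  (forall i, compact (A i)) ->
  compact [set f : {ptws I -> V} | forall i, A i (f i)].
Proof. exact: (@tychonoff {classic I} (fun _ => V)). Qed.

Section continuous_pointwise.
Variables (K : numFieldType) (X : topologicalType).
Implicit Types f g : X -> K.

Lemma contD f g : continuous f -> continuous g -> continuous (fun x => f x + g x).
Proof. by move=> cf cg x; apply: continuousD; [exact: cf|exact: cg]. Qed.

Lemma contB f g : continuous f -> continuous g -> continuous (fun x => f x - g x).
Proof. by move=> cf cg x; apply: continuousB; [exact: cf|exact: cg]. Qed.

Lemma contM f g : continuous f -> continuous g -> continuous (fun x => f x * g x).
Proof. by move=> cf cg x; apply: continuousM; [exact: cf|exact: cg]. Qed.

Lemma cont_norm f : continuous f -> continuous (fun x => `|f x|).
Proof.
by move=> cf x; apply: continuous_comp; [exact: cf|exact: norm_continuous].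
Qed.

Lemma cont_cst (c : K) : continuous (fun _ : X => c).
Proof. by move=> x; exact: cst_continuous. Qed.

Lemma cont_sum (I : Type) (r : seq I) (F : I -> X -> K) :
  (forall i, continuous (F i)) -> continuous (fun x => \sum_(i <- r) F i x).
Proof.
move=> cF; elim: r => [|i r IH].
  by rewrite (_ : (fun x => _) = (fun=> 0));
    [exact: cont_cst|apply/funext => x; rewrite big_nil].
rewrite (_ : (fun x => _) = (fun x => F i x + \sum_(j <- r) F j x)).
  exact: contD.
by apply/funext => x; rewrite big_cons.
Qed.

End continuous_pointwise.

Lemma cont_comp (X Y Z : topologicalType) (f : X -> Y) (g : Y -> Z) :
  continuous f -> continuous g -> continuous (fun x => g (f x)).
Proof. by move=> cf cg x; apply: continuous_comp; [exact: cf|exact: cg]. Qed.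

Lemma closed_eqfun (K : numFieldType) (X : topologicalType) (f g : X -> K) :
  continuous f -> continuous g -> closed [set x | f x = g x].
Proof.
move=> cf cg; rewrite (_ : [set x | _] = (fun x => f x - g x) @^-1` [set 0]).
  apply: closed_comp.
    by move=> x _; exact: contB.
  apply: compact_closed; [exact: norm_hausdorff|exact: compact_set1].
by apply/seteqP; split => x /= => [->|/eqP]; rewrite ?subrr// subr_eq0 => /eqP.
Qed.

Lemma closed_ge0fun (K : numFieldType) (X : topologicalType) (f : X -> K) :
  continuous f -> closed [set x | 0 <= f x].
Proof.
move=> cf; rewrite (_ : [set x | _] = [set x | `|f x| = f x]).
  by apply: closed_eqfun => //; exact: cont_norm.
by apply/seteqP; split => x /= /normr_idP.
Qed.

Lemma closed_forall (X : topologicalType) (I : Type) (P : I -> X -> Prop) :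
  (forall i, closed [set x | P i x]) -> closed [set x | forall i, P i x].
Proof.
move=> cP; rewrite (_ : [set x | _] = \bigcap_i [set x | P i x]).
  exact: closed_bigI.
by apply/seteqP; split => [x Px i _|x Px i]; [exact: Px|exact: (Px i Logic.I)].
Qed.

(** Lets side conditions such as boundedness of [f] stay inside a closed condition, since a false
    premise leaves the whole space. *)
Lemma closed_imply (X : topologicalType) (Q : Prop) (P : X -> Prop) :
  (Q -> closed [set x | P x]) -> closed [set x | Q -> P x].
Proof.
move=> cP; have [q|nq] := pselect Q.
  rewrite (_ : [set x | _] = [set x | P x]); first exact: cP.
  by apply/seteqP; split => x //= /(_ q).
rewrite (_ : [set x | _] = setT); first exact: closedT.
by apply/seteqP; split => // x _ /nq.
Qed.

Lemma compact_set_type (X : topologicalType) (A : set X) :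
  compact A -> compact [set: set_type A].
Proof.
move=> cA F FF _.
have FA : (set_val @ F) A.
  apply: (@filterS _ F _ setT); last exact: filterT.
  by move=> [x Ax] _; exact: set_mem Ax.
have [x [Ax cx]] := cA _ (fmap_proper_filter _ FF) FA.
exists (SigSub (mem_set Ax)); split => // U V FU [W [[Q oQ <-] Qx QV]].
have : (set_val @ F) (set_val @` U).
  by apply: (@filterS _ F _ U) FU => y Uy; exists y.
have xQ : nbhs x Q by exact: open_nbhs_nbhs.
move=> /cx /(_ xQ) [_ [[y Uy <-] Qy]].
by exists y; split => //; exact: QV.
Qed.

(** Ellis-Numakura: Zorn gives a minimal closed subsemigroup [A]. For [p] in [A], the set [A p] is
    compact by continuity of [op^~ p] and is a subsemigroup, so it equals [A]. Hence the closed
    subsemigroup of those [a] with [a p = p] is nonempty, equals [A], and contains [p]. *)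
Lemma ellis_idempotent (X : topologicalType) (op : X -> X -> X) (K : set X) :
  hausdorff_space X -> associative op -> (forall y, continuous (op^~ y)) ->
  compact K -> K !=set0 -> (forall x y, K x -> K y -> K (op x y)) ->
  exists2 p, K p & op p p = p.
Proof.
move=> hX opA opc cK K0 opK.
pose good A := [/\ closed A, A `<=` K, A !=set0 &
  forall x y, A x -> A y -> A (op x y)].
have gK : good K by split => //; exact: compact_closed.
pose T := {A | good A}.
pose r : rel T := fun A B => `[< sval B `<=` sval A >].
have [||||[A gA] Amin] := @Zorn T r.
- by move=> A; apply/asboolP.
- by move=> A B C /asboolP AB /asboolP BC; apply/asboolP; exact: subset_trans AB.
- move=> [A a] [B b] /asboolP/= AB /asboolP/= BA.
  by apply: eq_exist; apply/seteqP.
- move=> Ch totCh.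
  pose V (U : set X) : set X :=
    [set x | (exists2 t, Ch t & sval t = U) -> U x].
  have clV U : closed (V U).
    by apply: closed_imply => -[[B []]] ? ? ? ? _ /= <-.
  have fip (s : seq (set X)) : exists2 x, K x & {in s, forall U, V U x}.
    (* A finite part of a chain has a least member, with [K] standing in when no listed set belongs
       to the chain; any of its points will do. *)
    have : exists2 B : set X, good B & {in s, forall U,
        (exists2 t, Ch t & sval t = U) -> B `<=` U}
        /\ (B = K \/ exists2 t, Ch t & sval t = B).
      elim: s => [|U s [B gB [sB eB]]]; first by exists K => //; split => //; left.
      have [[t Ct tU]|nU] := pselect (exists2 t, Ch t & sval t = U); last first.
        exists B => //; split => // W; rewrite inE => /orP[/eqP ->|/sB//].
        by move=> /nU.
      have gU : good U by rewrite -tU; case: (t).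
      have [BU|nBU] := pselect (B `<=` U).
        by exists B => //; split => // W; rewrite inE => /orP[/eqP ->|/sB].
      have UB : U `<=` B.
        case: eB => [->|[t' Ct' t'B]]; first by case: gU.
        by have [] := totCh _ _ Ct Ct' => /asboolP; rewrite tU t'B.
      exists U => //; split; last by right; exists t.
      move=> W; rewrite inE => /orP[/eqP -> _|Ws /(sB _ Ws) BW].
        by [].
      exact: subset_trans BW.
    case=> B [_ BK [x Bx] _] [sB _]; exists x; first exact: BK.
    by move=> U Us /(sB _ Us); apply.
  have [x Kx xV] := compact_fip cK clV fip.
  have gI : good (K `&` [set x | forall t, Ch t -> sval t x]).
    split.
    - apply: closedI; first exact: compact_closed.
      apply: closed_forall => -[B gB]; apply: closed_imply => _ /=.
      by case: gB.
    - by move=> y [].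
    - exists x; split => // t Ct; apply: (xV (sval t)); by exists t.
    - move=> y z [Ky yC] [Kz zC]; split; first exact: opK.
      by move=> t Ct; have [_ _ _] := svalP t; apply; [exact: yC|exact: zC].
  exists (exist _ _ gI) => t Ct; apply/asboolP => y [_]; exact.
have {}Amin B : good B -> B `<=` A -> B = A.
  by move=> gB BA; have /(congr1 sval) := Amin (exist _ _ gB) (asboolT BA).
have [clA AK [p Ap] Aop] := gA.
have cA : compact A by exact: subclosed_compact AK.
exists p; first exact: AK.
have Ep : [set op a p | a in A] = A.
  apply: Amin; last by move=> _ [a Aa <-]; exact: Aop.
  split.
  - apply: compact_closed => //; apply: continuous_compact => //.
    by apply: continuous_subspaceT; exact: opc.
  - by move=> _ [a Aa <-]; apply: AK; exact: Aop.
  - by exists (op p p); exists p.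
  - move=> _ _ [a Aa <-] [b Ab <-]; exists (op (op a p) b); last by rewrite !opA.
    exact: Aop (Aop _ _ Aa Ap) Ab.
have [a Aa ap] : [set op a p | a in A] p by rewrite Ep.
have EW : A `&` (op^~ p @^-1` [set p]) = A.
  apply: Amin; last by move=> x [].
  split.
  - apply: closedI => //; apply: closed_comp; first by move=> x _; exact: opc.
    by apply: compact_closed => //; exact: compact_set1.
  - by move=> x [/AK].
  - by exists a.
  - by move=> x y [Ax xp] [Ay yp]; split; [exact: Aop|rewrite /= -opA yp].
by have [] : (A `&` (op^~ p @^-1` [set p])) p by rewrite EW.
Qed.

Lemma urysohn_point (R : realType) (X : topologicalType) (x : X) (C : set X) :
  hausdorff_space X -> compact [set: X] -> closed C -> ~ C x ->
  exists f : X -> R, [/\ continuous f, forall y, 0 <= f y <= 1, f x = 0 &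
    forall y, C y -> f y = 1].
Proof.
move=> hX cX clC nCx.
have /(_ [set x] C) := proj1 (@normal_separatorP R X) (compact_normal hX cX).
case/(_ _ clC _)/(proj1 (@uniform_separatorP X R _ _)) => //.
- by apply: compact_closed => //; exact: compact_set1.
- by apply/seteqP; split => y //= [-> /nCx].
move=> f [cf f01 fx fC]; exists f; split => //.
- by move=> y; have := f01 (f y); rewrite /= in_itv/=; apply; exists y.
- by apply: fx; exists x.
- by move=> y Cy; apply: fC; exists y.
Qed.

Lemma compact_real_bounded (R : realType) (X : topologicalType) (f : X -> R) :
  compact [set: X] -> continuous f ->
  exists2 M, 0 < M & forall x, `|f x| <= M.
Proof.
move=> cX cf; have : compact (range f).
  by apply: continuous_compact => //; exact: continuous_subspaceT.
move=> /compact_bounded [M [_ Mf]].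
exists (`|M| + 1); first by rewrite ltr_wpDl.
move=> x; apply: (Mf (`|M| + 1)); last by exists x.
by rewrite (le_lt_trans (ler_norm _))// ltrDl.
Qed.

(** * The topology of the complex plane through real and imaginary parts *)

Section complex_topology.
Variable R : realType.
Local Notation C := (CC R).

Definition rpart (z : C) : R := complex.Re z.
Definition ipart (z : C) : R := complex.Im z.
Definition inC (x : R) : C := Complex x 0.

Lemma inC_lt x y : (inC x < inC y) = (x < y). Proof. exact: ltcR. Qed.
Lemma inC_le x y : (inC x <= inC y) = (x <= y). Proof. exact: lecR. Qed.
Lemma inC0 : inC 0 = 0. Proof. by []. Qed.
Lemma inCD x y : inC (x + y) = inC x + inC y. Proof. exact: (rmorphD (real_complex R)). Qed.
Lemma inCB x y : inC (x - y) = inC x - inC y. Proof. exact: (rmorphB (real_complex R)). Qed.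
Lemma inCM x y : inC (x * y) = inC x * inC y. Proof. exact: (rmorphM (real_complex R)). Qed.
Lemma inC_norm x : `|inC x| = inC `|x|.
Proof. by rewrite [LHS]normc_def /= expr0n addr0 sqrtr_sqr. Qed.
Lemma inC_real (z : C) : z \is Num.real -> inC (rpart z) = z.
Proof. exact: RRe_real. Qed.
Lemma rpartD y z : rpart (y + z) = rpart y + rpart z.
Proof. by case: y z => [? ?] []. Qed.
Lemma ipartD y z : ipart (y + z) = ipart y + ipart z.
Proof. by case: y z => [? ?] []. Qed.
Lemma rpartM y z : rpart (y * z) = rpart y * rpart z - ipart y * ipart z.
Proof. by case: y z => [? ?] []. Qed.
Lemma ipartM y z : ipart (y * z) = rpart y * ipart z + ipart y * rpart z.
Proof. by case: y z => [? ?] []. Qed.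
Lemma parts_ge0 (z : C) : 0 <= z -> 0 <= rpart z /\ ipart z = 0.
Proof. by rewrite lecE => /andP[/eqP zi zr]; split. Qed.
Lemma parts_inj (y z : C) : rpart y = rpart z -> ipart y = ipart z -> y = z.
Proof. by case: y z => [? ?] [? ?] /= -> ->. Qed.
Lemma inC_gt0 (e : C) : 0 < e -> exists2 d, 0 < d & e = inC d.
Proof.
by move=> e0; exists (rpart e); rewrite -?inC_lt inC_real// ?gtr0_real.
Qed.

Lemma norm_rpart (z : C) : inC `|rpart z| <= `|z|.
Proof. exact: normc_ge_Re. Qed.

Lemma norm_ipart (z : C) : inC `|ipart z| <= `|z|.
Proof.
rewrite [leRHS]normc_def inC_le -sqrtr_sqr ler_sqrt ?lerDr ?sqr_ge0//.
by rewrite addr_ge0 ?sqr_ge0.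
Qed.

Lemma rpart_continuous : continuous rpart.
Proof.
move=> z U [e /= e0 eU]; exists (inC e) => [|y /= zy].
  by rewrite /= -inC0 inC_lt.
apply: eU => /=; rewrite -inC_lt; apply: le_lt_trans zy.
rewrite (_ : rpart z - rpart y = rpart (z - y)) ?norm_rpart//.
by case: (z) (y) => [? ?] [].
Qed.

Lemma ipart_continuous : continuous ipart.
Proof.
move=> z U [e /= e0 eU]; exists (inC e) => [|y /= zy].
  by rewrite /= -inC0 inC_lt.
apply: eU => /=; rewrite -inC_lt; apply: le_lt_trans zy.
rewrite (_ : ipart z - ipart y = ipart (z - y)) ?norm_ipart//.
by case: (z) (y) => [? ?] [].
Qed.

Lemma inC_continuous : continuous inC.
Proof.
move=> x U [_ /= /inC_gt0[e e0 ->] eU]; exists e => // y /= xy.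
by apply: eU; rewrite /= -inCB inC_norm inC_lt.
Qed.

(** The disc is a closed subset of the image of the square over [[-m, m]] under
    [(x, y) |-> x + i y]. *)
Lemma disc_compact (M : C) : compact [set z : C | `|z| <= M].
Proof.
pose m := rpart M.
pose g (p : R * R) : C := inC p.1 + 'i * inC p.2.
have cg : continuous g.
  apply: contD.
    by apply: cont_comp inC_continuous => p; exact: cvg_fst.
  apply: contM; first exact: cont_cst.
  by apply: cont_comp inC_continuous => p; exact: cvg_snd.
apply: (@subclosed_compact _ _ (g @` (`[-m, m] `*` `[-m, m]))).
- rewrite (_ : [set z | _] = [set z : C | 0 <= M - `|z|]); last first.
    by apply/seteqP; split => z /=; rewrite subr_ge0.
  apply: closed_ge0fun; apply: contB; first exact: cont_cst.
  exact: norm_continuous.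
- apply: continuous_compact; first exact: continuous_subspaceT.
  by apply: compact_setX; exact: segment_compact.
- move=> z /= zM; exists (rpart z, ipart z).
    have MR : inC m = M by rewrite inC_real// ger0_real// (le_trans _ zM).
    by split; rewrite /= in_itv/= -ler_norml -inC_le MR (le_trans _ zM)//
      ?norm_rpart ?norm_ipart.
  by rewrite /g /= -complexiE -complexE.
Qed.

Lemma CC_hausdorff : hausdorff_space C.
Proof. exact: norm_hausdorff. Qed.

End complex_topology.

(** * Means on bounded functions *)

Section bounded_functions.
Variables (R : realType) (G : groupType).
Local Notation C := (CC R).
Implicit Types (f g h : G -> C) (s t : G).

Lemma bdd_cst (c : C) : bdd (fun _ : G => c).
Proof. by exists `|c|. Qed.

Lemma bddD f g : bdd f -> bdd g -> bdd (fun t => f t + g t).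
Proof.
move=> [M fM] [N gN]; exists (M + N) => t.
by rewrite (le_trans (ler_normD _ _))// lerD.
Qed.

Lemma bddM f g : bdd f -> bdd g -> bdd (fun t => f t * g t).
Proof.
by move=> [M fM] [N gN]; exists (M * N) => t; rewrite normrM ler_pM.
Qed.

Lemma bddN f : bdd f -> bdd (fun t => - f t).
Proof. by move=> [M fM]; exists M => t; rewrite normrN. Qed.

Lemma bddX f n : bdd f -> bdd (fun t => f t ^+ n).
Proof.
by move=> [M fM]; exists (M ^+ n) => t; rewrite normrX lerXn2r// nnegrE (le_trans _ (fM t)).
Qed.

Lemma bdd_norm f : bdd f -> bdd (fun t => `|f t|).
Proof. by move=> [M fM]; exists M => t; rewrite normr_id. Qed.

Lemma bdd_conj f : bdd f -> bdd (fun t => (f t)^*).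
Proof. by move=> [M fM]; exists M => t; rewrite norm_conjC. Qed.

Lemma bdd_Re f : bdd f -> bdd (fun t => 'Re (f t)).
Proof.
move=> [M fM]; exists M => t; apply: le_trans (fM t).
by rewrite leif_normC_Re_Creal.
Qed.

Lemma bdd_Im f : bdd f -> bdd (fun t => 'Im (f t)).
Proof.
move=> bf; rewrite (_ : (fun _ => _) = fun t => 'Re (- 'i * f t)).
  by apply: bdd_Re; apply: bddM => //; exact: bdd_cst.
by apply/funext => t; rewrite mulNr raddfN/= ReMil opprK.
Qed.

Lemma bdd_sum (I : Type) (r : seq I) (F : I -> G -> C) :
  (forall i, bdd (F i)) -> bdd (fun t => \sum_(i <- r) F i t).
Proof.
move=> bF; elim: r => [|i r IH].
  rewrite (_ : (fun x => _) = (fun=> 0)); first exact: bdd_cst.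
  by apply/funext => x; rewrite big_nil.
rewrite (_ : (fun x => _) = (fun x => F i x + \sum_(j <- r) F j x)).
  exact: bddD.
by apply/funext => x; rewrite big_cons.
Qed.

Lemma bdd_ltrans s f : bdd f -> bdd (ltrans s f).
Proof. by move=> [M fM]; exists M => t; exact: fM. Qed.

Lemma ltransM s t f : ltrans s (ltrans t f) = ltrans (s * t)%g f.
Proof. by apply/funext => u; rewrite /ltrans invgM mulgA. Qed.

Lemma ltrans1 f : ltrans 1%g f = f.
Proof. by apply/funext => u; rewrite /ltrans invg1 mul1g. Qed.

Lemma bdd_ltransE s f : bdd (ltrans s f) -> bdd f.
Proof. by move/(bdd_ltrans s^-1); rewrite ltransM mulVg ltrans1. Qed.

(** Kept apart from positivity: characters are unital and linear by definition, whereas their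
    positivity is proved in [character_mean], where this calculus is already in use. *)
Definition ulin (mu : (G -> C) -> C) :=
  (forall (a : C) f h, bdd f -> bdd h ->
    mu (fun t => a * f t + h t) = a * mu f + mu h) /\ mu (fun _ => 1) = 1.

Definition mean (mu : (G -> C) -> C) :=
  ulin mu /\ forall f, bdd f -> (forall t, 0 <= f t) -> 0 <= mu f.

Section ulin.
Variable mu : (G -> C) -> C.
Hypothesis muL : ulin mu.

Lemma ulinD f g : bdd f -> bdd g -> mu (fun t => f t + g t) = mu f + mu g.
Proof.
move=> bf bg; rewrite -[mu f]mul1r -muL.1//; congr mu.
by apply/funext => t; rewrite mul1r.
Qed.

Lemma ulin0 : mu (fun=> 0) = 0.
Proof.
have := ulinD (bdd_cst 0) (bdd_cst 0).
by rewrite addr0 => /(congr1 (fun z => z - mu (fun=> 0))); rewrite subrr addrK.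
Qed.

Lemma ulinZ a f : bdd f -> mu (fun t => a * f t) = a * mu f.
Proof.
move=> bf; rewrite -[RHS]addr0 -ulin0 -muL.1//; last exact: bdd_cst.
by congr mu; apply/funext => t; rewrite addr0.
Qed.

Lemma ulin_cst a : mu (fun=> a) = a.
Proof.
rewrite -[RHS]mulr1 -muL.2 -ulinZ; last exact: bdd_cst.
by congr mu; apply/funext => t; rewrite mulr1.
Qed.

Lemma ulinN f : bdd f -> mu (fun t => - f t) = - mu f.
Proof.
move=> bf; rewrite -mulN1r -ulinZ//; congr mu.
by apply/funext => t; rewrite mulN1r.
Qed.

Lemma ulinB f g : bdd f -> bdd g -> mu (fun t => f t - g t) = mu f - mu g.
Proof. by move=> bf bg; rewrite ulinD ?ulinN//; exact: bddN. Qed.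

Lemma ulin_sum (I : Type) (r : seq I) (F : I -> G -> C) :
  (forall i, bdd (F i)) ->
  mu (fun t => \sum_(i <- r) F i t) = \sum_(i <- r) mu (F i).
Proof.
move=> bF; elim: r => [|i r IH].
  by rewrite big_nil -[RHS]ulin0; congr mu; apply/funext => t; rewrite big_nil.
rewrite big_cons -IH -ulinD//; last exact: bdd_sum.
by congr mu; apply/funext => t; rewrite big_cons.
Qed.

End ulin.

Section mean.
Variable mu : (G -> C) -> C.
Hypothesis mu_mean : mean mu.
Let muL := mu_mean.1.

Lemma mean_le f g : bdd f -> bdd g -> (forall t, f t <= g t) -> mu f <= mu g.
Proof.
move=> bf bg fg; rewrite -subr_ge0 -ulinB//; apply: mu_mean.2.
  by apply: bddD => //; exact: bddN.
by move=> t; rewrite subr_ge0.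
Qed.

(** If [M] bounds [|f|] then [f + M >= 0], so [mu f + M] is nonnegative and in particular real. *)
Lemma mean_real f : bdd f -> (forall t, f t \is Num.real) -> mu f \is Num.real.
Proof.
move=> bf rf; have [M fM] := bf.
have M0 : 0 <= M by rewrite (le_trans _ (fM 1%g)).
have : 0 <= mu (fun t => f t + M).
  apply: mu_mean.2 => [|t]; first by apply: bddD => //; exact: bdd_cst.
  have := fM t; rewrite real_ler_norml// => /andP[+ _].
  by rewrite -subr_ge0 opprK.
rewrite ulinD//; last exact: bdd_cst.
rewrite (ulin_cst muL) => /ger0_real rM.
by rewrite -[mu f](addrK M) rpredB// ger0_real.
Qed.

Lemma mean_Re_Im f : bdd f ->
  mu f = mu (fun t => 'Re (f t)) + 'i * mu (fun t => 'Im (f t)).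
Proof.
move=> bf; rewrite addrC -muL.1; [|exact: bdd_Im|exact: bdd_Re].
by congr mu; apply/funext => t; rewrite addrC -Crect.
Qed.

Lemma mean_Re f : bdd f -> mu (fun t => 'Re (f t)) = 'Re (mu f).
Proof.
move=> bf; rewrite (mean_Re_Im bf) Re_rect// mean_real//;
  by [exact: bdd_Re|exact: bdd_Im|move=> t; rewrite ?Creal_Re ?Creal_Im].
Qed.

Lemma mean_conj f : bdd f -> mu (fun t => (f t)^*) = (mu f)^*.
Proof.
move=> bf; have bR := bdd_Re bf; have bI := bdd_Im bf.
rewrite [in RHS](mean_Re_Im bf) conjC_rect; last 2 first.
- by apply: mean_real => // t; rewrite Creal_Re.
- by apply: mean_real => // t; rewrite Creal_Im.
rewrite addrC -mulNr -muL.1//; congr mu; apply/funext => t.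
by rewrite [in LHS](Crect (f t)) conjC_rect ?Creal_Re ?Creal_Im// mulNr addrC.
Qed.

Lemma mean_norm f M : (forall t, `|f t| <= M) -> `|mu f| <= M.
Proof.
move=> fM; have bf : bdd f by exists M.
(* The phase [z] rotates [mu f] to its modulus, so [|mu f|] equals [mu ('Re (z f))], and
   ['Re (z f) <= M] pointwise. *)
pose z := if mu f == 0 then 1 else `|mu f| / mu f.
have nz : `|z| = 1.
  rewrite /z; case: eqVneq => [_|f0]; first by rewrite normr1.
  by rewrite normrM normrV ?unitfE// normr_id divff// normr_eq0.
have zf : z * mu f = `|mu f|.
  rewrite /z; case: eqVneq => [->|f0]; first by rewrite mulr0 normr0.
  by rewrite divfK.
have bzf : bdd (fun t => z * f t) by apply: bddM => //; exact: bdd_cst.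
rewrite -zf -[leLHS](_ : 'Re (z * mu f) = _); last first.
  by apply/Creal_ReP; rewrite zf normr_real.
rewrite -ulinZ// -mean_Re// -[M](ulin_cst muL).
apply: mean_le => [||t]; [exact: bdd_Re|exact: bdd_cst|].
apply: le_trans (fM t); rewrite -[`|f t|]mul1r -nz -normrM.
apply: (@le_trans _ _ `|'Re (z * f t)|); last by rewrite leif_normC_Re_Creal.
by rewrite real_ler_norm// Creal_Re.
Qed.

(** This is nonnegativity of the variance [mu ((f - mu f)^2)]. *)
Lemma mean_schwarz f : bdd f -> (forall t, f t \is Num.real) ->
  mu f ^+ 2 <= mu (fun t => f t ^+ 2).
Proof.
move=> bf rf; have rmu := mean_real bf rf.
have : 0 <= mu (fun t => (f t - mu f) ^+ 2).
  apply: mu_mean.2 => [|t].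
    by apply: bddX; apply: bddD => //; exact: bdd_cst.
  by rewrite real_exprn_even_ge0// rpredB.
rewrite (_ : (fun t => _) = fun t => (- (2 * mu f)) * f t + (f t ^+ 2 + mu f ^+ 2)).
  rewrite muL.1//; last by apply: bddD; [exact: bddX|exact: bdd_cst].
  rewrite ulinD//; [|exact: bddX|exact: bdd_cst].
  rewrite (ulin_cst muL) => mu0; rewrite -subr_ge0; move: mu0.
  move: (mu f) (mu (fun t => f t ^+ 2)) => x y.
  by rewrite (_ : y - x ^+ 2 = - (2 * x) * x + (y + x ^+ 2)); last by ring.
by apply/funext => t; ring.
Qed.

End mean.
End bounded_functions.

(** * The Choi-Effros product *)

Section choi_effros.
Variables (R : realType) (G : groupType) (phi : (G -> CC R) -> (G -> CC R)).
Local Notation C := (CC R).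
Implicit Types (f g h : G -> C) (s t : G).
Hypothesis phiP : G_projection phi.

Lemma phi_bdd f : bdd f -> bdd (phi f).
Proof. by case: phiP => phib _ _; exact: phib. Qed.

Lemma phi_idem f : bdd f -> phi (phi f) = phi f.
Proof. by case: phiP => _ _ [_ _ _ phiI]; exact: phiI. Qed.

Lemma phi_ltrans s f : bdd f -> phi (ltrans s f) = ltrans s (phi f).
Proof. by case: phiP => _ _ [_ _ phiE _]; exact: phiE. Qed.

Lemma phi_mean t : mean (fun f => phi f t).
Proof.
case: phiP => _ phi1 [philin phipos _ _]; split; last by move=> f bf /phipos; exact.
by split; [move=> a f h bf bh; rewrite philin|rewrite phi1].
Qed.

Lemma phi_real f t : bdd f -> (forall t, f t \is Num.real) ->
  phi f t \is Num.real.
Proof. exact: (mean_real (phi_mean t)). Qed.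

Lemma quadratic_ge0_linear0 (x y : C) : x \is Num.real -> y \is Num.real ->
  (forall r : C, r \is Num.real -> 0 <= r * x + r ^+ 2 * y) -> x = 0.
Proof.
move=> rx ry H; have d0 : 0 < `|y| + 1 by rewrite ltr_wpDl.
have rd : `|y| + 1 \is Num.real by rewrite gtr0_real.
(* With [d = |y| + 1], the test value [r = - x / d] turns the expression into [(x / d)^2 (y - d)];
   as [y < d], this is nonnegative only for [x = 0]. *)
have /H : - x / (`|y| + 1) \is Num.real by rewrite rpred_div// rpredN.
set d := `|y| + 1 in d0 rd *.
rewrite (_ : _ + _ = (x / d) ^+ 2 * (y - d)); last first.
  by field; rewrite gt_eqF.
move=> q0; have yd : y - d < 0.
  by rewrite subr_lt0 /d (le_lt_trans (real_ler_norm ry))// ltrDl.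
have sq : 0 <= (x / d) ^+ 2 by rewrite real_exprn_even_ge0// rpred_div.
have : (x / d) ^+ 2 * (y - d) <= 0 by rewrite mulr_ge0_le0// ltW.
move=> /(conj q0) /andP; rewrite -eq_le eq_sym mulf_eq0 (lt_eqF yd) orbF.
by rewrite expf_eq0/= mulf_eq0 invr_eq0 (gt_eqF d0) orbF => /eqP.
Qed.

Lemma phi_sqrD (A k : G -> C) (r : C) t : bdd A -> bdd k ->
  phi (fun u => (A u + r * k u) ^+ 2) t =
  phi (fun u => A u ^+ 2) t + r * (2 * phi (fun u => A u * k u) t)
    + r ^+ 2 * phi (fun u => k u ^+ 2) t.
Proof.
move=> bA bk; have L := (phi_mean t).1.
have bAk := bddM bA bk; have bA2 := bddX 2 bA; have bk2 := bddX 2 bk.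
rewrite (_ : (fun u => _) =
  fun u => (2 * r) * (A u * k u) + (r ^+ 2 * k u ^+ 2 + A u ^+ 2)); last first.
  by apply/funext => u; ring.
rewrite L.1//; last by apply: bddD => //; apply: bddM => //; exact: bdd_cst.
by rewrite L.1//; ring.
Qed.

(** The Schwarz inequality for [phi f + r h], followed by one more application of [phi], gives [phi
    ((phi f + r phi h)^2) <= phi ((phi f + r h)^2)] for every real [r]. The constant terms in [r]
    agree, so the linear terms must agree as well. *)
Lemma choi_effros_real f h t : bdd f -> bdd h ->
  (forall t, f t \is Num.real) -> (forall t, h t \is Num.real) ->
  phi (fun u => phi f u * h u) t = phi (fun u => phi f u * phi h u) t.
Proof.
move=> bf bh rf rh.
have [bA bk] := (phi_bdd bf, phi_bdd bh).
have [rA rk] := ((fun u => phi_real u bf rf), (fun u => phi_real u bh rh)).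
apply/eqP; rewrite -subr_eq0.
suff : 2 * (phi (fun u => phi f u * h u) t - phi (fun u => phi f u * phi h u) t) = 0.
  by move/eqP; rewrite mulf_eq0 pnatr_eq0.
have rM k : bdd k -> (forall u, k u \is Num.real) ->
    phi (fun u => phi f u * k u) t \is Num.real.
  by move=> ? rk'; apply: phi_real => [|u]; [exact: bddM|rewrite rpredM].
have rX k : bdd k -> (forall u, k u \is Num.real) ->
    phi (fun u => k u ^+ 2) t \is Num.real.
  by move=> ? rk'; apply: phi_real => [|u]; [exact: bddX|rewrite rpredX].
apply: (@quadratic_ge0_linear0 _ (phi (fun u => h u ^+ 2) t
    - phi (fun u => phi h u ^+ 2) t)).
- by apply: rpredM; [exact: realn|rewrite rpredB// rM].
- by rewrite rpredB// rX.
move=> r rr.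
have bb : bdd (fun u => phi f u + r * h u).
  by apply: bddD => //; apply: bddM => //; exact: bdd_cst.
have bb' : bdd (fun u => phi f u + r * phi h u).
  by apply: bddD => //; apply: bddM => //; exact: bdd_cst.
have key : phi (fun u => (phi f u + r * phi h u) ^+ 2) t <=
           phi (fun u => (phi f u + r * h u) ^+ 2) t.
  rewrite -[in leRHS]phi_idem; last exact: bddX.
  apply: (mean_le (phi_mean t)); [exact: bddX|apply: phi_bdd; exact: bddX|].
  move=> u; have L := (phi_mean u).1.
  rewrite (_ : _ + _ = phi (fun u => phi f u + r * h u) u).
    by apply: (mean_schwarz (phi_mean u) bb) => v; rewrite rpredD// rpredM.
  rewrite (ulinD L)//; last by apply: bddM => //; exact: bdd_cst.
  by rewrite phi_idem// (ulinZ L).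
move: key; rewrite !phi_sqrD// -subr_ge0 => /le_trans; apply.
by rewrite le_eqVlt; apply/orP; left; apply/eqP; ring.
Qed.

Lemma phi_Re_Im f t : bdd f ->
  phi f t = phi (fun t => 'Re (f t)) t + 'i * phi (fun t => 'Im (f t)) t.
Proof. exact: (mean_Re_Im (phi_mean t)). Qed.

(** Both sides are complex bilinear, so splitting [f] and [h] into real and imaginary parts reduces
    to [choi_effros_real]. *)
Lemma choi_effros f h : bdd f -> bdd h ->
  phi (fun u => phi f u * h u) = phi (fun u => phi f u * phi h u).
Proof.
move=> bf bh; apply/funext => t; have L := (phi_mean t).1.
have [bfR bfI bhR bhI] :=
  And4 (bdd_Re bf) (bdd_Im bf) (bdd_Re bh) (bdd_Im bh).
have [bpfR bpfI bph] := And3 (phi_bdd bfR) (phi_bdd bfI) (phi_bdd bh).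
have [bphR bphI] := (phi_bdd bhR, phi_bdd bhI).
have real_h g : bdd g -> (forall u, g u \is Num.real) ->
    phi (fun u => phi g u * h u) t = phi (fun u => phi g u * phi h u) t.
  move=> bg rg; have bpg := phi_bdd bg.
  rewrite (_ : (fun u => _ * h u) = fun u =>
    'i * (phi g u * 'Im (h u)) + phi g u * 'Re (h u)); last first.
    by apply/funext => u; rewrite {1}(Crect (h u)); ring.
  rewrite (_ : (fun u => _ * phi h u) = fun u =>
    'i * (phi g u * phi (fun t => 'Im (h t)) u)
    + phi g u * phi (fun t => 'Re (h t)) u); last first.
    by apply/funext => u; rewrite (phi_Re_Im u bh); ring.
  rewrite !L.1; try exact: bddM.
  by congr (_ * _ + _); apply: choi_effros_real bg _ rg _.
rewrite (_ : (fun u => _ * h u) = fun u =>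
    'i * (phi (fun t => 'Im (f t)) u * h u)
    + phi (fun t => 'Re (f t)) u * h u); last first.
  by apply/funext => u; rewrite (phi_Re_Im u bf); ring.
rewrite (_ : (fun u => _ * phi h u) = fun u =>
    'i * (phi (fun t => 'Im (f t)) u * phi h u)
    + phi (fun t => 'Re (f t)) u * phi h u); last first.
  by apply/funext => u; rewrite (phi_Re_Im u bf); ring.
rewrite !L.1; try exact: bddM.
by congr (_ * _ + _); apply: real_h.
Qed.

Lemma character_ulin chi : Hamana_character phi chi -> ulin chi.
Proof. by case. Qed.

Lemma character_phi chi f : Hamana_character phi chi -> bdd f ->
  chi (phi f) = chi f.
Proof. by case=> _ chiphi _ _ _ bf; rewrite -chiphi. Qed.

Lemma characterM chi f h : Hamana_character phi chi -> bdd f -> bdd h ->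
  chi (fun u => phi f u * h u) = chi f * chi h.
Proof.
move=> chiC bf bh; have [_ _ _ _ chiM] := chiC.
rewrite -(character_phi chiC); last by apply: bddM => //; exact: phi_bdd.
by rewrite choi_effros// chiM// !(character_phi chiC).
Qed.

Lemma dist_nonneg_gt0 (l : C) : ~~ (0 <= l) ->
  exists2 d, 0 < d & forall x : C, 0 <= x -> d <= `|x - l|.
Proof.
move=> nl; have [lr|lnr] := boolP (l \is Num.real).
  have l0 : l < 0 by rewrite real_ltNge.
  exists (- l) => [|x x0]; first by rewrite oppr_gt0.
  by rewrite ger0_norm ?lerDr// subr_ge0 ltW// (lt_le_trans l0).
exists `|'Im l| => [|x x0].
  by rewrite normr_gt0; apply: contra lnr => /eqP/Creal_ImP.
have -> : `|'Im l| = `|'Re ('i * (x - l))|.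
  by rewrite ReMil raddfB/= (Creal_ImP _ (ger0_real x0)) sub0r opprK.
by rewrite (le_trans (leif_normC_Re_Creal _))// normrM normCi mul1r.
Qed.

(* If [chi f] were not nonnegative, [phi f - chi f] would have a bounded
   pointwise inverse; multiplicativity of [chi] forbids this, [phi f - chi f]
   being in its kernel. *)
Lemma character_mean chi : Hamana_character phi chi -> mean chi.
Proof.
move=> chiC; have L := character_ulin chiC; split=> // f bf f0.
have [//|/dist_nonneg_gt0 [d d0 dl]] := boolP (0 <= chi f).
have pf0 t : 0 <= phi f t by exact: (phi_mean t).2.
pose c u := (phi f u - chi f)^-1.
have bc : bdd c.
  exists d^-1 => u; rewrite /c normrV ?unitfE; last first.
    by rewrite -normr_gt0 (lt_le_trans d0)// dl.
  by rewrite lef_pV2 ?dl// posrE// (lt_le_trans d0)// dl.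
have bfl : bdd (fun t => f t - chi f) by apply: bddD => //; exact: bdd_cst.
have := characterM chiC bfl bc.
rewrite (ulinB L)//; last exact: bdd_cst.
rewrite (ulin_cst L) subrr mul0r (_ : (fun u => _) = fun=> 1).
  by rewrite L.2 => /eqP; rewrite oner_eq0.
apply/funext => u; rewrite (ulinB (phi_mean u).1)//; last exact: bdd_cst.
rewrite (ulin_cst (phi_mean u).1) mulfV//.
by rewrite -normr_gt0 (lt_le_trans d0)// dl.
Qed.

End choi_effros.

(** * The compact space of means *)

Section mean_space.
Variables (R : realType) (G : groupType).
Local Notation C := (CC R).
Local Notation T := {ptws (G -> C) -> C}.
Implicit Types (f g h : G -> C) (s t : G).

(** The value 0 off the bounded functions makes a mean determined by its bounded part and confines
    every coordinate to a disc; it matches the encoding of [Hamana_character]. *)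
Definition zmean (mu : T) := mean mu /\ forall f, ~ bdd f -> mu f = 0.

Lemma zmean_closed : closed [set mu : T | zmean mu].
Proof.
have ev f := @ptws_eval_continuous (G -> C) C f.
apply: closedI; last first.
  apply: closed_forall => f; apply: closed_imply => _.
  by apply: closed_eqfun => //; exact: cont_cst.
apply: closedI; last first.
  apply: closed_forall => f; do 2 (apply: closed_imply => _).
  exact: closed_ge0fun.
apply: closedI; last by apply: closed_eqfun => //; exact: cont_cst.
apply: closed_forall => a; apply: closed_forall => f; apply: closed_forall => h.
do 2 (apply: closed_imply => _); apply: closed_eqfun => //.
by apply: contD => //; apply: contM => //; exact: cont_cst.
Qed.

(** Banach-Alaoglu: by [mean_norm] the coordinate at [f] stays in a disc whose radius bounds [f], so
    the means are closed in a Tychonoff product of discs. *)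
Lemma zmean_compact : compact [set mu : T | zmean mu].
Proof.
have /choice [M HM] : forall f, exists M : C, bdd f -> forall t, `|f t| <= M.
  by move=> f; have [[M ?]|nb] := pselect (bdd f); [exists M|exists 0].
pose N f : C := if `[< bdd f >] then M f else 0.
apply: (subclosed_compact zmean_closed).
  by apply: (@ptws_compact _ C (fun f => [set z : C | `|z| <= N f])) => f;
    exact: disc_compact.
move=> mu [mum mu0] f /=; rewrite /N; case: asboolP => bf.
  by apply: (mean_norm mum); exact: HM.
by rewrite mu0// normr0.
Qed.

Definition point_mean t : T := fun f => if `[< bdd f >] then f t else 0.

Lemma point_meanE t f : bdd f -> point_mean t f = f t.
Proof. by move=> bf; rewrite /point_mean; case: asboolP. Qed.

Lemma point_mean_zmean t : zmean (point_mean t).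
Proof.
split; last by move=> f nf; rewrite /point_mean; case: asboolP.
split; last by move=> f bf f0; rewrite point_meanE.
split; last by rewrite point_meanE//; exact: bdd_cst.
move=> a f h bf bh; rewrite !point_meanE//.
by apply: bddD => //; apply: bddM => //; exact: bdd_cst.
Qed.

End mean_space.

(** * Existence of characters *)

Section characters_exist.
Variables (R : realType) (G : groupType) (phi : (G -> CC R) -> (G -> CC R)).
Local Notation C := (CC R).
Local Notation T := {ptws (G -> C) -> C}.
Implicit Types (f g h : G -> C) (s t : G).
Hypothesis phiP : G_projection phi.

(** Pointwise product minus Choi-Effros product of [phi f] and [phi h]. A pointwise multiplicative
    mean that kills all defects becomes a character once composed with [phi]. *)
Let defect f h : G -> C :=
  fun u => phi f u * phi h u - phi (fun u => phi f u * phi h u) u.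

Let defect_bdd f h : bdd f -> bdd h -> bdd (defect f h).
Proof.
move=> bf bh; have bM : bdd (fun u => phi f u * phi h u).
  by apply: bddM; exact: phi_bdd.
by apply: bddD => //; apply: bddN; exact: phi_bdd.
Qed.

(** The conjugate [c] of the defect satisfies [phi c = 0], hence [phi (phi k * c) = 0] for bounded
    [k] by [choi_effros]. Expanding one factor of [|defect|^2 = defect * c] leaves only terms of
    this type. *)
Let defect_norm f h t : bdd f -> bdd h ->
  phi (fun u => `|defect f h u| ^+ 2) t = 0.
Proof.
move=> bf bh; have L t' := (phi_mean phiP t').1.
have [bpf bph bd] := And3 (phi_bdd phiP bf) (phi_bdd phiP bh) (defect_bdd bf bh).
have bM := bddM bpf bph; have bpM := phi_bdd phiP bM.
have bc := bdd_conj bd; set c := fun u => (defect f h u)^* in bc.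
have pc0 : phi c = fun=> 0.
  apply/funext => u; rewrite /c (mean_conj (phi_mean phiP u))//.
  by rewrite /defect (ulinB (L u))// phi_idem// subrr conjC0.
have abs0 k : bdd k -> phi (fun u => phi k u * c u) = fun=> 0.
  move=> bk; rewrite choi_effros// pc0.
  rewrite (_ : (fun u => _) = fun=> 0); last by apply/funext => u; rewrite mulr0.
  by apply/funext => u; exact: (ulin0 (L u)).
rewrite (_ : (fun u => _) = fun u => phi f u * (phi h u * c u)
    - phi (fun u => phi f u * phi h u) u * c u); last first.
  by apply/funext => u; rewrite normCK -/(c u) /defect; ring.
have bhc := bddM bph bc; rewrite (ulinB (L t)); try exact: bddM.
rewrite choi_effros// abs0// abs0// subr0.
rewrite (_ : (fun u => _) = fun=> 0); last by apply/funext => u; rewrite mulr0.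
exact: (ulin0 (L t)).
Qed.

(** Point evaluations are multiplicative, so a limit of evaluations at points where ever more
    defects are small is a multiplicative mean [m] with [m (defect f h) = 0]; the character is [m]
    after [phi]. *)
Lemma character_exists : exists chi, Hamana_character phi chi.
Proof.
pose ok (i : (G -> C) * (G -> C) * C) := [/\ bdd i.1.1, bdd i.1.2 & 0 < i.2].
pose V i : set T := [set m : T | ok i ->
  m (fun u => i.1.1 u * i.1.2 u) = m i.1.1 * m i.1.2 /\
  0 <= i.2 - `|m (defect i.1.1 i.1.2)|].
have ev f := @ptws_eval_continuous (G -> C) C f.
have clV i : closed (V i).
  apply: closed_imply => _; apply: closedI.
    by apply: closed_eqfun => //; exact: contM.
  by apply: closed_ge0fun; apply: contB; [exact: cont_cst|exact: cont_norm].
have fip (r : seq ((G -> C) * (G -> C) * C)) :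
    exists2 m, zmean m & {in r, forall i, V i m}.
  suff [t tP] : exists t, {in r, forall i, ok i ->
      `|defect i.1.1 i.1.2 t| <= i.2}.
    exists (point_mean t) => [|i ir [b1 b2 e0]]; first exact: point_mean_zmean.
    have bd := defect_bdd b1 b2.
    rewrite !point_meanE//; last exact: bddM.
    by split => //; rewrite subr_ge0; exact: tP.
  apply: contrapT => /forallNP nt.
  (* The weight is scaled to be at least 1 wherever the defect exceeds its tolerance. If every point
     failed some condition of [r], the sum of weights would be at least 1 everywhere, although [phi]
     sends it to 0. *)
  pose w i u : C := if `[< ok i >] then
    (i.2 ^- 2) * `|defect i.1.1 i.1.2 u| ^+ 2 else 0.
  have bw i : bdd (w i).
    rewrite /w; case: asboolP => [[b1 b2 _]|_]; last exact: bdd_cst.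
    apply: bddM; first exact: bdd_cst.
    by apply: bddX; apply: bdd_norm; exact: defect_bdd.
  have L := (phi_mean phiP 1%g).1.
  have w0 i : phi (w i) 1%g = 0.
    rewrite /w; case: asboolP => [[b1 b2 _]|_]; last exact: (ulin0 L).
    rewrite (ulinZ L) ?defect_norm ?mulr0//.
    by apply: bddX; apply: bdd_norm; exact: defect_bdd.
  have wge0 i u : 0 <= w i u.
    rewrite /w; case: asboolP => [[b1 b2 e0]|//].
    by rewrite mulr_ge0 ?exprn_ge0 ?invr_ge0 ?exprn_ge0// ltW.
  have : 1 <= phi (fun u => \sum_(i <- r) w i u) 1%g.
    rewrite -[leLHS](ulin_cst L); apply: (mean_le (phi_mean phiP _));
      [exact: bdd_cst|exact: bdd_sum|move=> u].
    have /existsNP [i /not_implyP [ir /not_implyP [oki /negP]]] := nt u.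
    have [_ _ e0] := oki.
    rewrite -real_ltNge ?normr_real ?gtr0_real// => lt.
    rewrite (big_rem i ir)/= ler_wpDr ?sumr_ge0//.
    rewrite /w; case: asboolP => // _.
    by rewrite ler_pdivlMl ?exprn_gt0// mulr1 lerXn2r ?nnegrE// ltW.
  rewrite (ulin_sum L)// big1; last by move=> i _; exact: w0.
  by rewrite ler10.
have [m [mm m0] mV] := compact_fip (@zmean_compact R G) clV fip.
have mL := mm.1.
have mM f h : bdd f -> bdd h -> m (fun u => f u * h u) = m f * m h.
  by move=> bf bh; have [] := mV (f, h, 1) (And3 bf bh ltr01).
have md f h : bdd f -> bdd h -> m (defect f h) = 0.
  move=> bf bh; apply/eqP; rewrite -normr_le0; apply/ler_addgt0Pl => e e0.
  by rewrite addr0 -subr_ge0; have [] := mV (f, h, e) (And3 bf bh e0).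
pose chi f : C := if `[< bdd f >] then m (phi f) else 0.
have chiE f : bdd f -> chi f = m (phi f).
  by move=> bf; rewrite /chi; case: asboolP.
have [phib phi1 [philin _ _ _]] := phiP.
exists chi; split.
- by move=> f nf; rewrite /chi; case: asboolP.
- by move=> f bf; rewrite !chiE ?phi_idem//; exact: phib.
- move=> a f h bf bh; rewrite !chiE//; last first.
    by apply: bddD => //; apply: bddM => //; exact: bdd_cst.
  by rewrite philin// mL.1//; exact: phib.
- by rewrite chiE ?phi1 ?mL.2//; exact: bdd_cst.
- move=> f h bf bh; have [bpf bph] := (phib _ bf, phib _ bh).
  have bM := bddM bpf bph; have bpM := phib _ bM.
  rewrite !chiE// !phi_idem// -mM//.
  have := md f h bf bh; rewrite /defect (ulinB mL)// => /eqP.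
  by rewrite subr_eq0 => /eqP.
Qed.

End characters_exist.

(** * Rigidity *)

Section rigidity.
Variables (R : realType) (G : groupType) (phi : (G -> CC R) -> (G -> CC R)).
Local Notation C := (CC R).
Local Notation T := {ptws (G -> C) -> C}.
Implicit Types (f g h : G -> C) (s t : G) (mu nu : T).

(** This is the function [t |-> mu (u |-> f (t u))]: an equivariant operator on l^oo(G) whose value
    at the identity is [mu f]. *)
Definition transl mu f : G -> C := fun t => mu (ltrans t^-1 f).

(** The extension of the group law to means. As [mu] is applied last, continuity holds in the left
    factor, which is the side [ellis_idempotent] asks for. *)
Definition conv mu nu : T := fun f => mu (transl nu f).

Lemma transl_ltrans nu s f : transl nu (ltrans s f) = ltrans s (transl nu f).
Proof.
by apply/funext => t; rewrite /transl ltransM [RHS]/ltrans invgM invgK.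
Qed.

Lemma transl_conv mu nu f : transl (conv mu nu) f = transl mu (transl nu f).
Proof. by apply/funext => t; rewrite /transl /conv transl_ltrans. Qed.

Lemma convA : associative conv.
Proof. by move=> a b c; apply/funext => f; rewrite /conv transl_conv. Qed.

Lemma conv_continuous nu : continuous (conv^~ nu).
Proof.
apply: continuous_ptws => f.
exact: (@ptws_eval_continuous (G -> C) C (transl nu f)).
Qed.

Lemma transl_bdd nu f : mean nu -> bdd f -> bdd (transl nu f).
Proof.
by move=> num [M fM]; exists M => t; apply: (mean_norm num) => u; exact: fM.
Qed.

Lemma transl_lin nu (a : C) f h : mean nu -> bdd f -> bdd h ->
  transl nu (fun t => a * f t + h t) = fun t => a * transl nu f t + transl nu h t.
Proof.
move=> num bf bh; apply/funext => t; rewrite /transl.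
by rewrite -num.1.1//; exact: bdd_ltrans.
Qed.

Lemma transl_ge0 nu f : mean nu -> bdd f -> (forall t, 0 <= f t) ->
  forall t, 0 <= transl nu f t.
Proof.
by move=> num bf f0 t; apply: num.2 => [|u]; [exact: bdd_ltrans|exact: f0].
Qed.

Lemma conv_zmean mu nu : zmean mu -> zmean nu -> zmean (conv mu nu).
Proof.
move=> [mum mu0] [num nu0]; split; last first.
  move=> f nf; rewrite /conv (_ : transl nu f = fun=> 0); first exact: ulin0 mum.1.
  by apply/funext => t; apply: nu0 => /bdd_ltransE.
split; last first.
  move=> f bf f0; apply: mum.2; first exact: transl_bdd.
  exact: transl_ge0.
split; last by rewrite /conv (_ : transl nu _ = fun=> 1) ?mum.1.2//;
  apply/funext => t; exact: num.1.2.
move=> a f h bf bh; rewrite /conv transl_lin// mum.1.1//; exact: transl_bdd.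
Qed.

Lemma average_zmean (m : nat -> T) n : (forall k, zmean (m k)) ->
  zmean (fun f => n.+1%:R^-1 * \sum_(k < n.+1) m k f).
Proof.
move=> mz; have n0 : n.+1%:R != 0 :> C by rewrite pnatr_eq0.
split; last first.
  move=> f nf; rewrite big1 ?mulr0// => k _; exact: (mz k).2.
split; last first.
  move=> f bf f0; rewrite mulr_ge0 ?invr_ge0// sumr_ge0// => k _.
  exact: (mz k).1.2.
split; last first.
  rewrite (eq_bigr (fun=> 1)); last by move=> k _; exact: (mz k).1.1.2.
  by rewrite sumr_const card_ord mulVf.
move=> a f h bf bh.
rewrite (eq_bigr (fun k : 'I_n.+1 => a * m k f + m k h)); last first.
  by move=> k _; exact: (mz k).1.1.1.
by rewrite big_split/= -mulr_sumr; ring.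
Qed.

Hypothesis phiP : G_projection phi.

(** These are the states of the range of [phi], written as functionals on l^oo(G). *)
Definition pmean mu := zmean mu /\ forall f, bdd f -> mu (phi f) = mu f.

Lemma pmean_closed : closed [set mu : T | pmean mu].
Proof.
apply: closedI; first exact: zmean_closed.
apply: closed_forall => f; apply: closed_imply => _.
by apply: closed_eqfun; exact: (@ptws_eval_continuous (G -> C) C).
Qed.

Lemma pmean_compact : compact [set mu : T | pmean mu].
Proof.
apply: (subclosed_compact pmean_closed (@zmean_compact R G)).
by move=> mu [].
Qed.

Lemma transl_phi nu f : pmean nu -> bdd f -> transl nu (phi f) = transl nu f.
Proof.
move=> [_ nuphi] bf; apply/funext => t; rewrite /transl -phi_ltrans//.
by apply: nuphi; exact: bdd_ltrans.
Qed.

(** Invariance under [phi] of the right factor suffices, because [phi] commutes with the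
    translations inside [transl nu]. *)
Lemma conv_pmean mu nu : zmean mu -> pmean nu -> pmean (conv mu nu).
Proof.
move=> muz nup; split; first exact: conv_zmean nup.1.
by move=> f bf; rewrite /conv transl_phi.
Qed.

Lemma archimedean_bound (M e : C) : 0 <= M -> 0 < e ->
  exists N, forall n, (N <= n)%N -> n.+1%:R^-1 * M <= e.
Proof.
move=> M0 e0; have r0 : 0 <= M / e by rewrite divr_ge0// ltW.
exists (Num.truncn (rpart (M / e))) => n Nn.
rewrite mulrC ler_pdivrMr// mulrC -ler_pdivrMr// -[leLHS]inC_real ?ger0_real//.
rewrite (_ : n.+1%:R = inC n.+1%:R); last first.
  exact: esym (rmorph_nat (real_complex R) n.+1).
by rewrite inC_le ltW// (lt_le_trans (truncnS_gt _))// ler_nat.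
Qed.

(* Cesaro averages of the convolution powers of [nu] are asymptotically
   invariant under right convolution by [nu]. *)
Lemma exists_invariant_mean nu : pmean nu ->
  exists2 w, pmean w & forall f, bdd f -> w (transl nu f) = w f.
Proof.
move=> nup; have num := nup.1.1.
pose pw := fix pw k : T := if k is k'.+1 then conv (pw k') nu else nu.
have pwP k : pmean (pw k) by elim: k => //= k [IH _]; exact: conv_pmean.
pose av n : T := fun f => n.+1%:R^-1 * \sum_(k < n.+1) pw k f.
have avP n : pmean (av n).
  split; first by apply: average_zmean => k; exact: (pwP k).1.
  move=> f bf; rewrite /av; congr (_ * _); apply: eq_bigr => k _.
  exact: (pwP k).2.
(* The sum telescopes because [pw k (transl nu f)] is by definition [pw k.+1 f]. *)
have avB n f : av n (transl nu f) - av n f = n.+1%:R^-1 * (pw n.+1 f - pw 0 f).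
  rewrite /av -mulrBr; congr (_ * _).
  rewrite -sumrB -(big_mkord xpredT (fun k => pw k (transl nu f) - pw k f)).
  exact: (@telescope_sumr _ 0 n.+1 (fun k => pw k f)).
pose ok (i : (G -> C) * C) := bdd i.1 /\ 0 < i.2.
pose V i : set T := [set w : T | ok i ->
  0 <= i.2 - `|w (transl nu i.1) - w i.1|].
have ev f := @ptws_eval_continuous (G -> C) C f.
have clV i : closed (V i).
  apply: closed_imply => _; apply: closed_ge0fun; apply: contB.
    exact: cont_cst.
  by apply: cont_norm; exact: contB.
have fip (r : seq ((G -> C) * C)) : exists2 w, pmean w & {in r, forall i, V i w}.
  (* If [M] bounds [f], the error at [f] is at most [2 M / (n + 1)], so each condition holds for all
     large [n] and finitely many hold from a common [N] on. *)
  suff [N NP] : exists N, {in r, forall i, forall n, (N <= n)%N -> V i (av n)}.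
    by exists (av N) => // i ir; exact: NP.
  elim: r => [|i r [N NP]]; first by exists 0.
  have [N' N'P] : exists N', forall n, (N' <= n)%N -> V i (av n).
    have [[[M fM] e0]|nok] := pselect (ok i); last by exists 0 => n _ /nok.
    have M0 : 0 <= M by rewrite (le_trans _ (fM 1%g)).
    have [N' N'P] := archimedean_bound (addr_ge0 M0 M0) e0.
    exists N' => n /N'P nN _; rewrite /= subr_ge0 avB normrM.
    rewrite ger0_norm ?invr_ge0// (le_trans _ nN)// ler_wpM2l ?invr_ge0//.
    rewrite (le_trans (ler_normB _ _))// lerD// (mean_norm _ fM)//.
    exact: (pwP n.+1).1.1.
  exists (maxn N N') => j; rewrite inE => /orP[/eqP ->|jr] n; rewrite geq_max => /andP[Nn N'n].
    exact: N'P.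
  exact: NP.
have [w wp wV] := compact_fip pmean_compact clV fip.
exists w => // f bf; apply/eqP; rewrite -subr_eq0 -normr_le0.
apply/ler_addgt0Pl => e e0; rewrite addr0 -subr_ge0.
exact: (wV (f, e) (conj bf e0)).
Qed.

Hypothesis phi_min : forall psi, G_projection psi -> proj_le psi phi ->
  forall f, bdd f -> psi f = phi f.

(* For an idempotent [p] with [p * nu = p], the map [phi \o transl p] is a
   G-projection below [phi]. *)
Lemma rigidity nu f : pmean nu -> bdd f -> phi (transl nu f) = phi f.
Proof.
move=> nup bf; have num := nup.1.1.
pose K : set T := [set w : T | pmean w] `&`
  [set w | forall f, bdd f -> w (transl nu f) = w f].
have Ktransl w g : K w -> bdd g -> transl w (transl nu g) = transl w g.
  move=> [_ wnu] bg; apply/funext => t; rewrite /transl -transl_ltrans.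
  by apply: wnu; exact: bdd_ltrans.
have cK : compact K.
  apply: compact_closedI; first exact: pmean_compact.
  apply: closed_forall => g; apply: closed_imply => _.
  by apply: closed_eqfun; exact: (@ptws_eval_continuous (G -> C) C).
have K0 : K !=set0 by have [w wp wnu] := exists_invariant_mean nup; exists w.
have convK x y : K x -> K y -> K (conv x y).
  move=> [xp xnu] Ky; split; first by apply: conv_pmean; [exact: xp.1|exact: Ky.1].
  by move=> g bg; rewrite /conv Ktransl.
have [p Kp pp] := ellis_idempotent (ptws_hausdorff (@CC_hausdorff R)) convA
  conv_continuous cK K0 convK.
have pp' := Kp.1; have pm := pp'.1.1.
pose psi g := phi (transl p g).
have psiE g : bdd g -> psi g = phi g.
  have tb g' : bdd g' -> bdd (transl p g') by exact: transl_bdd.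
  have [phib phi1 [philin phipos phieq phiid]] := phiP.
  apply: phi_min.
    split.
    - by move=> g' bg'; apply: phib; exact: tb.
    - rewrite /psi (_ : transl p _ = fun=> 1)//.
      by apply/funext => t; exact: pm.1.2.
    split.
    - by move=> a g' h bg bh; rewrite /psi transl_lin// philin//; exact: tb.
    - move=> g' bg' g0; apply: phipos; [exact: tb|exact: transl_ge0].
    - by move=> s g' bg'; rewrite /psi transl_ltrans phieq//; exact: tb.
    (* The inner [phi] is absorbed by [transl p], and [p * p = p] then gives idempotence. *)
    - move=> g' bg'; rewrite /psi transl_phi//; last exact: tb.
      by rewrite -transl_conv pp.
  move=> g' bg'; rewrite /psi transl_phi// phiid//; exact: tb.
(* The chain is [phi (transl nu f) = phi (transl p (transl nu f)) = phi (transl p f) = phi f]; the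
   outer equalities are [psi = phi], the middle one is [p * nu = p]. *)
rewrite -psiE; last exact: transl_bdd.
by rewrite /psi Ktransl//; exact: psiE.
Qed.

(** The values of [m] on the translates of [h] make up [transl m h]. Were they all at least [e],
    then [x (transl m h) >= e], whereas [rigidity] gives [x (transl m h) = x h = 0]. *)
Lemma small_translate x m h (e : C) : Hamana_character phi x -> pmean m ->
  bdd h -> (forall t, 0 <= h t) -> x h = 0 -> 0 < e ->
  exists s, m (ltrans s^-1 h) < e.
Proof.
move=> xC mp bh h0 xh e0; have xm := character_mean phiP xC.
apply: contrapT => /forallNP nlt.
have bt := transl_bdd mp.1.1 bh.
have : x (fun=> e) <= x (transl m h).
  apply: (mean_le xm) => // [|s]; first exact: bdd_cst.
  rewrite real_leNgt; [exact/negP/nlt|exact: gtr0_real|].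
  exact/ger0_real/(transl_ge0 mp.1.1 bh h0).
rewrite (ulin_cst xm.1) -(character_phi xC)// rigidity// (character_phi xC)// xh.
by move=> /(lt_le_trans e0); rewrite ltxx.
Qed.

End rigidity.

(** * The Hamana boundary *)

Lemma injective_hausdorff (X Y : topologicalType) (f : X -> Y) :
  continuous f -> injective f -> hausdorff_space Y -> hausdorff_space X.
Proof.
move=> cf fI hY p q pq; apply/fI/hY => A B Ap Bq.
by have [y []] := pq _ _ (cf _ _ Ap) (cf _ _ Bq); exists (f y).
Qed.

Lemma continuous_set_type (X Y : topologicalType) (A : set Y)
    (g : X -> set_type A) :
  continuous (fun x => set_val (g x)) -> continuous g.
Proof.
move=> cg x U [W [[Q oQ <-] Qx QU]]; apply: (filterS QU).
by apply: (cg x); exact: open_nbhs_nbhs.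
Qed.

(** * States on real continuous functions *)

Section prob_state.
Variables (R : realType) (X : topologicalType) (nu : (X -> R) -> R).
Hypothesis nuP : prob_state nu.
Implicit Types f g : X -> R.

Lemma prob_stateD f g : continuous f -> continuous g ->
  nu (fun x => f x + g x) = nu f + nu g.
Proof.
case: nuP => lin _ _ cf cg; rewrite -[nu f]mul1r -lin//; congr nu.
by apply/funext => x; rewrite mul1r.
Qed.

Lemma prob_state0 : nu (fun=> 0) = 0.
Proof.
have := prob_stateD (@cont_cst _ _ 0) (@cont_cst _ _ 0).
by rewrite addr0 => /(congr1 (fun z => z - nu (fun=> 0))); rewrite subrr addrK.
Qed.

Lemma prob_stateZ a f : continuous f -> nu (fun x => a * f x) = a * nu f.
Proof.
case: nuP => lin _ _ cf; rewrite -[RHS]addr0 -prob_state0 -lin//.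
  by congr nu; apply/funext => x; rewrite addr0.
exact: cont_cst.
Qed.

Lemma prob_state_cst a : nu (fun=> a) = a.
Proof.
case: nuP => _ _ nu1; rewrite -[RHS]mulr1 -nu1 -prob_stateZ; last exact: cont_cst.
by congr nu; apply/funext => x; rewrite mulr1.
Qed.

Lemma prob_stateB f g : continuous f -> continuous g ->
  nu (fun x => f x - g x) = nu f - nu g.
Proof.
case: nuP => lin _ _ cf cg; rewrite addrC -mulN1r -lin//; congr nu.
by apply/funext => x; rewrite mulN1r addrC.
Qed.

Lemma prob_state_le f g : continuous f -> continuous g ->
  (forall x, f x <= g x) -> nu f <= nu g.
Proof.
case: nuP => _ pos _ cf cg fg; rewrite -subr_ge0 -prob_stateB//.
by apply: pos => [|x]; [exact: contB|rewrite subr_ge0].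
Qed.

Lemma prob_state_sum (I : Type) (r : seq I) (F : I -> X -> R) :
  (forall i, continuous (F i)) ->
  nu (fun x => \sum_(i <- r) F i x) = \sum_(i <- r) nu (F i).
Proof.
move=> cF; elim: r => [|i r IH].
  by rewrite big_nil -[RHS]prob_state0; congr nu; apply/funext => x; rewrite big_nil.
rewrite big_cons -IH -prob_stateD//; last exact: cont_sum.
by congr nu; apply/funext => x; rewrite big_cons.
Qed.

End prob_state.

Lemma state_act_prob_state (R : realType) (G : groupType) (X : topologicalType)
    (act : G -> X -> X) (nu : (X -> R) -> R) s :
  continuous (act s) -> prob_state nu -> prob_state (state_act act s nu).
Proof.
move=> cs [lin pos nu1]; split => // [a f g cf cg|f cf f0].
  by rewrite /state_act lin//; exact: cont_comp.
by apply: pos => //; exact: cont_comp.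
Qed.

(** * The character space as a G-boundary *)

Section Hamana_boundary.
Variables (R : realType) (G : groupType) (phi : (G -> CC R) -> (G -> CC R)).
Local Notation C := (CC R).
Local Notation T := {ptws (G -> C) -> C}.
Local Notation X := (Hamana_boundary phi).
Local Notation act := (Hamana_act phi).
Implicit Types (f g h : G -> C) (s t : G) (x y : X).

Definition hval x : (G -> C) -> C := set_val x.

Lemma hvalP x : Hamana_character phi (hval x).
Proof. by case: x => x xA; exact: set_mem xA. Qed.

Lemma hval_bdd_inj x y : (forall f, bdd f -> hval x f = hval y f) -> x = y.
Proof.
move=> xy; apply: val_inj; apply/funext => f.
change (hval x f = hval y f).
have [bf|nf] := pselect (bdd f); first exact: xy.
have [x0 _ _ _ _] := hvalP x; have [y0 _ _ _ _] := hvalP y.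
by rewrite x0// y0.
Qed.

Lemma hval_continuous f : continuous (fun x => hval x f).
Proof.
apply: (@cont_comp X T C set_val (fun u => u f)).
  exact: initial_continuous.
exact: ptws_eval_continuous.
Qed.

Lemma continuous_Hamana (Y : topologicalType) (g : Y -> X) :
  (forall f, continuous (fun z => hval (g z) f)) -> continuous g.
Proof. by move=> cg; apply: continuous_set_type; exact: continuous_ptws. Qed.

Lemma Hamana_hausdorff : hausdorff_space X.
Proof.
apply: (@injective_hausdorff X T set_val).
- exact: initial_continuous.
- exact: val_inj.
- exact: ptws_hausdorff (@CC_hausdorff R).
Qed.

Hypothesis phiP : G_projection phi.

Lemma character_pmean (chi : T) : Hamana_character phi chi -> pmean phi chi.
Proof.
move=> chiC; have [chi0 _ _ _ _] := chiC; split; last first.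
  by move=> f bf; exact: character_phi chiC bf.
by split => //; exact: (character_mean phiP).
Qed.

Lemma hval_mean x : mean (hval x).
Proof. exact: character_mean (hvalP x). Qed.

Lemma hval_pmean x : pmean phi (hval x).
Proof. exact: character_pmean (hvalP x). Qed.

(** The characters are cut out by closed conditions and, being positive, lie in the compact set of
    [pmean]s. *)
Lemma Hamana_compact : compact [set: X].
Proof.
apply: compact_set_type.
have ev f := @ptws_eval_continuous (G -> C) C f.
apply: (subclosed_compact _ (@pmean_compact R G phi)); last exact: character_pmean.
rewrite (_ : (Hamana_character phi : set T) =
  [set chi : T | (forall f, ~ bdd f -> chi f = 0)] `&`
  ([set chi | (forall f, bdd f -> chi f = chi (phi f))] `&`
  ([set chi | (forall (a : C) f h, bdd f -> bdd h ->
         chi (fun t => a * f t + h t) = a * chi f + chi h)] `&`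
  ([set chi | chi (fun _ => 1) = 1] `&`
   [set chi | (forall f h, bdd f -> bdd h ->
      chi (phi (fun t => phi f t * phi h t)) = chi (phi f) * chi (phi h))])))).
  apply: closedI.
    apply: closed_forall => f; apply: closed_imply => _.
    by apply: closed_eqfun => //; exact: cont_cst.
  apply: closedI.
    apply: closed_forall => f; apply: closed_imply => _; exact: closed_eqfun.
  apply: closedI.
    apply: closed_forall => a; apply: closed_forall => f.
    apply: closed_forall => h; do 2 (apply: closed_imply => _).
    apply: closed_eqfun => //; apply: contD => //.
    by apply: contM => //; exact: cont_cst.
  apply: closedI; first by apply: closed_eqfun => //; exact: cont_cst.
  apply: closed_forall => f; apply: closed_forall => h.
  do 2 (apply: closed_imply => _); apply: closed_eqfun => //; exact: contM.
by apply/seteqP; split => chi; [case|move=> [? [? [? [? ?]]]]].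
Qed.

Lemma character_ltrans (chi : T) s : Hamana_character phi chi ->
  Hamana_character phi (fun f => chi (ltrans s f)).
Proof.
move=> [chi0 chiphi chilin chi1 chiM]; split => //.
- by move=> f nf; apply: chi0 => /bdd_ltransE.
- move=> f bf; have bsf := bdd_ltrans s bf.
  by rewrite -phi_ltrans// -chiphi.
- by move=> a f h bf bh; rewrite -chilin//; exact: bdd_ltrans.
- move=> f h bf bh; have [bsf bsh] := (bdd_ltrans s bf, bdd_ltrans s bh).
  rewrite -(phi_ltrans phiP); last by apply: bddM; exact: phi_bdd.
  have [Ef Eh] := (phi_ltrans phiP s bf, phi_ltrans phiP s bh).
  by rewrite -Ef -Eh -chiM// Ef Eh.
Qed.

Lemma hval_act s x f : hval (act s x) f = hval x (ltrans s^-1 f).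
Proof.
rewrite /hval /Hamana_act set_valE val_insubd ifT//.
exact/mem_set/(character_ltrans s^-1 (hvalP x)).
Qed.

Lemma Hamana_nonempty : [set: X] !=set0.
Proof.
have [chi chiC] := character_exists phiP.
by exists (SigSub (mem_set chiC : chi \in (Hamana_character phi : set T))).
Qed.

Lemma Hamana_compact_Gspace : compact_Gspace R act.
Proof.
split; [exact: Hamana_nonempty|exact: Hamana_compact|exact: Hamana_hausdorff|].
split.
- by move=> x; apply: hval_bdd_inj => f _; rewrite hval_act invg1 ltrans1.
- by move=> s t x; apply: hval_bdd_inj => f _; rewrite !hval_act ltransM invgM.
- move=> s; apply: continuous_Hamana => f.
  rewrite (_ : (fun y => _) = fun x => hval x (ltrans s^-1 f)).
    exact: hval_continuous.
  by apply/funext => x; rewrite hval_act.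
Qed.

(** Multiplicativity applied to [phi f - x f] and its conjugate. This produces nonnegative functions
    that vanish at [x] and are positive at a given other character. *)
Lemma character_sqdist x y f : bdd f ->
  hval y (fun u => `|phi f u - hval x f| ^+ 2) = `|hval y f - hval x f| ^+ 2.
Proof.
move=> bf; set c := hval x f; have L u := (phi_mean phiP u).1.
have yL := (hval_mean y).1.
have bfc : bdd (fun u => f u - c) by apply: bddD => //; exact: bdd_cst.
have bpfc : bdd (fun u => phi f u - c).
  by apply: bddD; [exact: phi_bdd|exact: bdd_cst].
have E : phi (fun u => f u - c) = fun u => phi f u - c.
  apply/funext => u; rewrite (ulinB (L u))//; last exact: bdd_cst.
  by rewrite (ulin_cst (L u)).
rewrite (_ : (fun u => _) =
    fun u => phi (fun u => f u - c) u * (phi f u - c)^*); last first.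
  by apply/funext => u; rewrite normCK E.
rewrite (characterM phiP (hvalP y))//; last exact: bdd_conj.
rewrite (mean_conj (hval_mean y))// -E (character_phi (hvalP y))//.
by rewrite (ulinB yL)//; [rewrite (ulin_cst yL) normCK|exact: bdd_cst].
Qed.

Lemma character_separation x (D : set X) : closed D -> ~ D x ->
  exists h, [/\ bdd h, (forall t, 0 <= h t), hval x h = 0 &
    forall y, D y -> 1 < hval y h].
Proof.
move=> clD nDx.
pose ok h := [/\ bdd h, (forall t, 0 <= h t) & hval x h = 0].
pose V h : set X := [set y | ok h -> 0 <= 1 - hval y h].
have clV h : closed (V h).
  apply: closed_imply => _; apply: closed_ge0fun.
  by apply: contB; [exact: cont_cst|exact: hval_continuous].
have cD : compact D by exact: subclosed_compact Hamana_compact _.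
apply: contrapT => nh; have := @compact_fip X _ D V cD clV.
case; last first.
  move=> y Dy yV; apply: nDx; rewrite (_ : x = y)//; apply: hval_bdd_inj => f bf.
  apply/eqP; apply: contrapT => /negP xy.
  have d0 : 0 < `|hval y f - hval x f| ^+ 2.
    by rewrite exprn_gt0// normr_gt0 subr_eq0 eq_sym.
  (* The scaling gives [hval y h = 2], so [y] violates the condition [V h]. *)
  pose h u := 2 / `|hval y f - hval x f| ^+ 2 * `|phi f u - hval x f| ^+ 2.
  have bs : bdd (fun u => `|phi f u - hval x f| ^+ 2).
    apply: bddX; apply: bdd_norm; apply: bddD; first exact: phi_bdd.
    exact: bdd_cst.
  have hE z : hval z h = 2 / `|hval y f - hval x f| ^+ 2 * `|hval z f - hval x f| ^+ 2.
    by rewrite /h (ulinZ (hval_mean z).1)// character_sqdist.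
  have /yV : ok h.
    split; first by apply: bddM => //; exact: bdd_cst.
      by move=> t; rewrite mulr_ge0 ?exprn_ge0// divr_ge0// ltW.
    by rewrite hE subrr normr0 expr0n mulr0.
  by rewrite hE divfK ?gt_eqF// subr_ge0 lern1.
move=> r; apply: contrapT => /forall2NP nr; apply: nh.
(* By compactness finitely many functions in [r] suffice: at each point of [D] one of them exceeds
   1, so their sum separates. Inadmissible members of [r] are replaced by 0. *)
pose w i : G -> C := if `[< ok i >] then i else fun=> 0.
have wok i : ok (w i).
  rewrite /w; case: asboolP => // _; split => //; first exact: bdd_cst.
  exact: ulin0 (hval_mean x).1.
have bw i : bdd (w i) by case: (wok i).
have w0 i t : 0 <= w i t by case: (wok i).
exists (fun t => \sum_(i <- r) w i t); split.
- exact: bdd_sum.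
- by move=> t; rewrite sumr_ge0.
- rewrite (ulin_sum (hval_mean x).1)// big1// => i _; by case: (wok i).
move=> y Dy; have [//|/existsNP [i /not_implyP [ir /not_implyP [oki /negP]]]] := nr y.
have y0 j : 0 <= hval y (w j) by exact: (hval_mean y).2.
rewrite (ulin_sum (hval_mean y).1)// (big_rem i ir)/=.
have -> : w i = i by rewrite /w; case: asboolP.
rewrite subr_ge0 -real_ltNge ?real1//; last first.
  by rewrite ger0_real//; have [? ? _] := oki; exact: (hval_mean y).2.
by move=> /lt_le_trans; apply; rewrite lerDl sumr_ge0.
Qed.

Hypothesis phi_min : forall psi, G_projection psi -> proj_le psi phi ->
  forall f, bdd f -> psi f = phi f.

(** If [x] lay outside the orbit closure of [y], some [h] would vanish at [x] and exceed 1 on that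
    closure, while [small_translate] finds an orbit point where it is below 1. *)
Lemma Hamana_minimal : minimal_action act.
Proof.
move=> y; apply/seteqP; split => // x _; apply: contrapT => nx.
have [h [bh h0 xh hD]] := character_separation (@closed_closure X _) nx.
have [s] := small_translate phiP phi_min (hvalP x) (hval_pmean y) bh h0 xh ltr01.
rewrite -hval_act => lt1.
have /hD/(lt_trans lt1) : closure (range (fun s => act s y)) (act s y).
  by apply: subset_closure; exists s.
by rewrite ltxx.
Qed.

(** The complex-linear extension of [nu], evaluated on the Gelfand transform [x |-> hval x f]. *)
Definition state_mean (nu : (X -> R) -> R) : T := fun f =>
  Complex (nu (fun x => rpart (hval x f))) (nu (fun x => ipart (hval x f))).

Lemma state_mean_pmean nu : prob_state nu -> pmean phi (state_mean nu).
Proof.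
move=> nuP; have [lin pos nu1] := nuP.
have cr f : continuous (fun x => rpart (hval x f)).
  by apply: cont_comp (@rpart_continuous R); exact: hval_continuous.
have ci f : continuous (fun x => ipart (hval x f)).
  by apply: cont_comp (@ipart_continuous R); exact: hval_continuous.
have nE (F : X -> R) c : (forall x, F x = c) -> nu F = c.
  move=> Fc; rewrite -[RHS](prob_state_cst nuP); congr nu; exact/funext.
split; last first.
  move=> f bf; rewrite /state_mean.
  by congr Complex; congr nu; apply/funext => x; rewrite (character_phi (hvalP x)).
split; last first.
  move=> f nf; apply: parts_inj; apply: nE => x;
    by have [x0 _ _ _ _] := hvalP x; rewrite x0.
split; last first.
  move=> f bf f0; have x0 x : 0 <= hval x f by exact: (hval_mean x).2.
  rewrite lecE /=; apply/andP; split.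
    by apply/eqP; apply: nE => x; have [] := parts_ge0 (x0 x).
  by apply: pos => // x; have [] := parts_ge0 (x0 x).
split; last first.
  by apply: parts_inj; apply: nE => x; rewrite (hval_mean x).1.2.
move=> a f h bf bh; have xL x := (hval_mean x).1.1 a f h bf bh.
have cc (b : R) (u v : X -> R) : continuous u -> continuous v ->
    continuous (fun x => b * u x + v x).
  by move=> cu cv; apply: contD => //; apply: contM => //; exact: cont_cst.
apply: parts_inj.
  transitivity (nu (fun x => rpart a * rpart (hval x f) +
      (- ipart a * ipart (hval x f) + rpart (hval x h)))).
    by congr nu; apply/funext => x; rewrite xL rpartD rpartM; ring.
  by rewrite !lin ?rpartD ?rpartM//=; [ring|exact: cc].
transitivity (nu (fun x => rpart a * ipart (hval x f) +
    (ipart a * rpart (hval x f) + ipart (hval x h)))).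
  by congr nu; apply/funext => x; rewrite xL ipartD ipartM; ring.
by rewrite !lin ?ipartD ?ipartM//=; [ring|exact: cc].
Qed.

(** Any [x] serves. The sum [F] of the deviations from [x] is below [e / 2] off [D], and on [D] a
    function [h] vanishing at [x] exceeds 1; moving [nu] so that it nearly kills [h] makes the mean
    of [F] smaller than [e]. *)
Lemma Hamana_strongly_proximal : strongly_proximal R act.
Proof.
move=> nu nuP; have [x _] := Hamana_nonempty; exists x => n f cf e e0.
have [_ _ _ [_ _ cact]] := Hamana_compact_Gspace.
pose F y := \sum_(i < n) `|f i y - f i x|.
have cF : continuous F.
  apply: cont_sum => i; apply: cont_norm.
  by apply: contB => //; exact: cont_cst.
have F0 y : 0 <= F y by rewrite sumr_ge0.
have [M M0 FM] := compact_real_bounded Hamana_compact cF.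
pose D : set X := [set y | 0 <= F y - e / 2].
have clD : closed D.
  by apply: closed_ge0fun; apply: contB => //; exact: cont_cst.
have nDx : ~ D x.
  rewrite /D /= /F big1 ?sub0r ?oppr_ge0 => [|i _]; last by rewrite subrr normr0.
  by apply/negP; rewrite -ltNge divr_gt0.
have [h [bh h0 xh hD]] := character_separation clD nDx.
(* As [F <= M], this tolerance for [h] limits the contribution of [D] to [e / 2]. *)
have e'0 : 0 < inC (e / 2 / M) by rewrite -inC0 inC_lt !divr_gt0.
have mP := state_mean_pmean nuP.
have [s] := small_translate phiP phi_min (hvalP x) mP bh h0 xh e'0.
rewrite ltcE /= => /andP[_ lts]; exists s => i.
have sP := state_act_prob_state (cact s) nuP.
set nus := state_act act s nu in sP *.
have chr : continuous (fun y => rpart (hval y h)).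
  by apply: cont_comp (@rpart_continuous R); exact: hval_continuous.
have {}lts : nus (fun y => rpart (hval y h)) < e / 2 / M.
  move: lts; congr (_ < _); rewrite /nus /state_act; congr nu.
  by apply/funext => y; rewrite hval_act.
have le1 : nus F <= e / 2 + M * nus (fun y => rpart (hval y h)).
  rewrite -[e / 2](prob_state_cst sP) -(prob_stateZ sP)// -(prob_stateD sP).
  - apply: (prob_state_le sP) => //.
      by apply: contD; [exact: cont_cst|apply: contM => //; exact: cont_cst].
    move=> y; have [yh0 _] := parts_ge0 ((hval_mean y).2 h bh h0).
    have [ltF|geF] := ltP (F y) (e / 2).
      by rewrite (le_trans (ltW ltF))// lerDl mulr_ge0// ltW.
    have /hD : D y by rewrite /D /= subr_ge0.
    rewrite ltcE => /andP[_ /= h1].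
    apply: (@le_trans _ _ M); first by rewrite (le_trans (ler_norm _)).
    rewrite -[leLHS]mulr1 ler_wpDl//; first by rewrite divr_ge0// ltW.
    by rewrite ler_pM2l// ltW.
  - exact: cont_cst.
  - by apply: contM => //; exact: cont_cst.
have le2 : nus F < e.
  rewrite (le_lt_trans le1)// -ltrBrDl (_ : e - e / 2 = M * (e / 2 / M)).
    by rewrite ltr_pM2l.
  by field; rewrite gt_eqF.
apply: le_lt_trans le2.
have cfx : continuous (fun y => f i y - f i x).
  by apply: contB => //; exact: cont_cst.
have -> : nus (f i) - f i x = nus (fun y => f i y - f i x).
  rewrite (prob_stateB sP)//; last exact: cont_cst.
  by rewrite (prob_state_cst sP).
have leF y : `|f i y - f i x| <= F y.
  by rewrite /F (bigD1 i)//= lerDl sumr_ge0.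
rewrite ler_norml; apply/andP; split; last first.
  apply: (prob_state_le sP) => // y; exact: le_trans (ler_norm _) (leF y).
rewrite -mulN1r -(prob_stateZ sP)//; apply: (prob_state_le sP) => //.
  by apply: contM => //; exact: cont_cst.
by move=> y; rewrite mulN1r; have := leF y; rewrite ler_norml => /andP[].
Qed.

Lemma Hamana_G_boundary : G_boundary R act.
Proof.
split; [exact: Hamana_compact_Gspace|exact: Hamana_minimal|].
exact: Hamana_strongly_proximal.
Qed.

End Hamana_boundary.

(** * Maps onto boundaries *)

(** Replaces a tolerance: an error bound of 1 for all multiples [c f] forces exact equality for
    [f]. *)
Lemma scaled_le1_eq0 (R : realType) (a : R) :
  (forall c, `|c * a| <= 1) -> a = 0.
Proof.
move=> ca; apply/eqP; apply: contrapT => /negP a0.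
have := ca (2 / a); rewrite divfK// ger0_norm//; lra.
Qed.

(** Preserving squares makes each variance [nu ((f - nu f)^2)] zero. A finite sum of such squares
    therefore cannot be at least 1 everywhere, so finitely many [f] are within 1 of [nu f] at a
    common point. *)
Lemma multiplicative_state_dirac (R : realType) (X : topologicalType)
    (nu : (X -> R) -> R) :
  compact [set: X] -> prob_state nu ->
  (forall f : X -> R, continuous f -> nu (fun x => f x ^+ 2) = nu f ^+ 2) ->
  exists x, forall f, continuous f -> nu f = f x.
Proof.
move=> cX nuP nuM.
pose V (f : X -> R) : set X := [set x | continuous f -> 0 <= 1 - `|nu f - f x|].
have clV f : closed (V f).
  apply: closed_imply => cf; apply: closed_ge0fun.
  apply: contB; first exact: cont_cst.
  by apply: cont_norm; apply: contB => //; exact: cont_cst.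
have [r|x _ xV] := compact_fip cX clV; last first.
  exists x => f cf; apply/eqP; rewrite -subr_eq0; apply/eqP.
  apply: scaled_le1_eq0 => c; rewrite mulrBr -(prob_stateZ nuP)// -subr_ge0.
  by apply: (xV (fun x => c * f x)); apply: contM => //; exact: cont_cst.
apply: contrapT => /forall2NP nr.
pose w f x := if `[< continuous f >] then (f x - nu f) ^+ 2 else 0.
have w0 f x : 0 <= w f x by rewrite /w; case: asboolP => // _; exact: sqr_ge0.
have cw f : continuous (w f).
  rewrite /w; case: asboolP => cf; last exact: cont_cst.
  have cB : continuous (fun x => f x - nu f).
    by apply: contB => //; exact: cont_cst.
  exact: contM.
have nuw f : nu (w f) = 0.
  rewrite /w; case: asboolP => cf; last exact: prob_state0 nuP.
  rewrite nuM; last by apply: contB => //; exact: cont_cst.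
  rewrite (prob_stateB nuP)//; last exact: cont_cst.
  by rewrite (prob_state_cst nuP) subrr expr0n.
have : 1 <= nu (fun x => \sum_(f <- r) w f x).
  rewrite -[leLHS](prob_state_cst nuP); apply: (prob_state_le nuP).
  - exact: cont_cst.
  - exact: cont_sum.
  move=> x; have [/(_ Logic.I)//|/existsNP [f /not_implyP [fr /not_implyP [cf /negP]]]] := nr x.
  rewrite subr_ge0 -ltNge => lt1.
  rewrite (big_rem f fr)/= ler_wpDr ?sumr_ge0//.
  rewrite /w; case: asboolP => // _.
  by rewrite -real_normK ?num_real// distrC expr_ge1// ltW.
by rewrite (prob_state_sum nuP)// big1 ?ler10.
Qed.

Section boundary_map.
Variables (R : realType) (G : groupType) (phi : (G -> CC R) -> (G -> CC R)).
Local Notation C := (CC R).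
Local Notation X := (Hamana_boundary phi).
Local Notation act := (Hamana_act phi).
Hypothesis phiP : G_projection phi.
Hypothesis phi_min : forall psi, G_projection psi -> proj_le psi phi ->
  forall f, bdd f -> psi f = phi f.
Variables (B : topologicalType) (actB : G -> B -> B).
Hypothesis actBP : G_boundary R actB.
Variable b : B.

Definition orbit_fun (f : B -> R) : G -> C := fun t => inC (f (actB t b)).

(** The Poisson transform: [f] is pulled back to G along the orbit of the base point [b] and
    evaluated at the character [x]. *)
Definition poisson_state (x : X) (f : B -> R) : R := rpart (hval x (orbit_fun f)).

Let cB : compact [set: B]. Proof. by case: actBP => -[]. Qed.
Let hB : hausdorff_space B. Proof. by case: actBP => -[]. Qed.

Let actBM s t y : actB (s * t)%g y = actB s (actB t y).
Proof. by case: actBP => -[_ _ _ [_ actM _]] _ _; exact: actM. Qed.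

Let actBc s : continuous (actB s).
Proof. by case: actBP => -[_ _ _ [_ _ actc]] _ _; exact: actc. Qed.

Let orbit_fun_bdd f : continuous f -> bdd (orbit_fun f).
Proof.
move=> cf; have [M _ fM] := compact_real_bounded cB cf.
by exists (inC M) => t; rewrite inC_norm inC_le.
Qed.

Let poisson_state_act s x f :
  poisson_state (act s x) f = poisson_state x (fun y => f (actB s y)).
Proof.
rewrite /poisson_state hval_act//; congr (rpart (hval x _)).
by apply/funext => t; rewrite /orbit_fun /ltrans invgK actBM.
Qed.

Let poisson_state_prob x : prob_state (poisson_state x).
Proof.
have xm := hval_mean phiP x.
split.
- move=> a f g cf cg; rewrite /poisson_state.
  rewrite (_ : orbit_fun _ =
      fun t => inC a * orbit_fun f t + orbit_fun g t); last first.
    by apply/funext => t; rewrite /orbit_fun inCD inCM.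
  rewrite xm.1.1; [|exact: orbit_fun_bdd..].
  by rewrite rpartD rpartM /= mul0r subr0.
- move=> f cf f0; have : 0 <= hval x (orbit_fun f).
    by apply: xm.2 => [|t]; [exact: orbit_fun_bdd|rewrite -inC0 inC_le].
  by move/parts_ge0 => [].
- by rewrite /poisson_state (_ : orbit_fun _ = fun=> 1) ?xm.1.2.
Qed.

Let poisson_state_continuous f : continuous (poisson_state^~ f).
Proof. by apply: cont_comp (@rpart_continuous R); exact: hval_continuous. Qed.

(** Strong proximality of [B] brings translates of one Poisson state near a point mass. Translates
    are the Poisson states of [act s x0], so compactness of the character space yields a character
    attaining the limit. *)
Lemma poisson_dirac_exists : exists x y, forall f, continuous f ->
  poisson_state x f = f y.
Proof.
have [x0 _] := Hamana_nonempty phiP.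
have [_ _ /(_ _ (poisson_state_prob x0)) [y yP]] := actBP.
pose V (f : B -> R) : set X :=
  [set x | continuous f -> 0 <= 1 - `|poisson_state x f - f y|].
have clV f : closed (V f).
  apply: closed_imply => cf; apply: closed_ge0fun.
  apply: contB; first exact: cont_cst.
  by apply: cont_norm; apply: contB => //; exact: cont_cst.
have [r|x _ xV] := compact_fip (Hamana_compact phiP) clV; last first.
  exists x, y => f cf; apply/eqP; rewrite -subr_eq0; apply/eqP.
  apply: scaled_le1_eq0 => c.
  rewrite mulrBr -(prob_stateZ (poisson_state_prob x))// -subr_ge0.
  by apply: (xV (fun z => c * f z)); apply: contM => //; exact: cont_cst.
pose w (f : B -> R) : B -> R := if `[< continuous f >] then f else fun=> 0.
have cw f : continuous (w f).
  by rewrite /w; case: asboolP => // _; exact: cont_cst.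
have [s sP] := yP (size r) (fun i => w (nth (fun=> 0) r i)) (fun i => cw _) 1 ltr01.
exists (act s x0) => // f fr cf; rewrite subr_ge0 poisson_state_act.
have fi : (index f r < size r)%N by rewrite index_mem.
have := sP (Ordinal fi); rewrite /= nth_index// /w; case: asboolP => // _.
exact: ltW.
Qed.

(** Being a point mass is replaced by preserving squares, visibly a closed condition on [x]. It
    holds along the orbit of [x1], which is dense by minimality. *)
Lemma poisson_dirac x : exists y, forall f, continuous f ->
  poisson_state x f = f y.
Proof.
apply: (multiplicative_state_dirac cB (poisson_state_prob x)).
have [x1 [y x1y]] := poisson_dirac_exists.
pose D : set X := [set x | forall f : B -> R, continuous f ->
  poisson_state x (fun z => f z ^+ 2) = poisson_state x f ^+ 2].
have clD : closed D.
  apply: closed_forall => f; apply: closed_imply => cf; apply: closed_eqfun.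
    exact: poisson_state_continuous.
  by apply: contM; exact: poisson_state_continuous.
have sub : range (fun s => act s x1) `<=` D.
  move=> _ [s _ <-] f cf; rewrite !poisson_state_act.
  have cfs : continuous (fun z => f (actB s z)) by exact: cont_comp.
  by rewrite !x1y//; exact: contM.
suff : D x by [].
by apply: clD; apply: (closure_subset sub); rewrite (Hamana_minimal phiP).
Qed.

Lemma boundary_factor : equivariant_factor act actB.
Proof.
have [p pP] := choice poisson_dirac.
have cp : continuous p.
  move=> x U; rewrite nbhsE => -[W [oW Wx] WU].
  have [||f [cf _ f0 f1]] := @urysohn_point R B (p x) (~` W) hB cB.
  - exact: open_closedC.
  - by apply.
  (* Since [poisson_state z f = f (p z)] and [f = 1] off [W], the open condition
     [poisson_state z f < 1] forces [p z] into [W]. *)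
  have : nbhs x ((poisson_state^~ f) @^-1` [set z | z < 1]).
    apply: (@poisson_state_continuous f x).
    by apply: open_nbhs_nbhs; split; [exact: open_lt|rewrite /= pP// f0].
  apply: filterS => z /= lt1; apply: WU; apply: contrapT => nW.
  by move: lt1; rewrite pP// f1// ltxx.
have ep : equivariant act actB p.
  move=> s x; apply: contrapT => ne.
  have [||f [cf _ f0 f1]] :=
    @urysohn_point R B (p (act s x)) [set actB s (p x)] hB cB.
  - by apply: compact_closed => //; exact: compact_set1.
  - by move=> /= /ne.
  have := pP (act s x) f cf; rewrite f0 poisson_state_act (pP x).
    by rewrite f1// => /eqP; rewrite oner_eq0.
  exact: cont_comp.
exists p; split => // y; have [x _] := Hamana_nonempty phiP.
(* Surjectivity: the range is compact, hence closed, and contains an orbit, which is dense in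
   [B]. *)
have clp : closed (range p).
  apply: compact_closed => //; apply: continuous_compact.
    exact: continuous_subspaceT.
  exact: (Hamana_compact phiP).
suff [z _ <-] : range p y by exists z.
have sub : range (fun s => actB s (p x)) `<=` range p.
  by move=> _ [s _ <-]; exists (act s x).
apply: clp; apply: (closure_subset sub).
by have [_ /(_ (p x)) -> _] := actBP.
Qed.

End boundary_map.

(** Strong proximality applied to the midpoint of the point masses at [y0] and [g y0] moves both
    points towards one [z], so [g z = z]. Then [g] fixes the orbit of [z], which is dense. *)
Lemma boundary_endomorphism_id (R : realType) (G : groupType)
    (Y : topologicalType) (act : G -> Y -> Y) (g : Y -> Y) :
  G_boundary R act -> continuous g -> equivariant act act g ->
  forall y, g y = y.
Proof.
move=> [[[y0 _] cY hY [_ _ actc]] minY proxY] cg eg.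
have sep y z : y <> z -> exists f : Y -> R,
    [/\ continuous f, forall u, 0 <= f u <= 1, f y = 0 & f z = 1].
  move=> yz; have [||f [cf f01 f0 f1]] := @urysohn_point R Y y [set z] hY cY.
  - by apply: compact_closed => //; exact: compact_set1.
  - by [].
  by exists f; split => //; exact: f1.
have [z gz] : exists z, g z = z.
  pose nu (f : Y -> R) := 2^-1 * (f y0 + f (g y0)).
  have nuP : prob_state nu.
    split; rewrite /nu.
    - by move=> a f h _ _; ring.
    - by move=> f _ f0; rewrite mulr_ge0 ?invr_ge0// addr_ge0.
    - by field.
  have [z zP] := proxY nu nuP; exists z; apply: contrapT => /nesym/sep.
  move=> [f [cf f01 f0 f1]].
  (* Test [f] and its composite with [g], whose values at [z] are 0 and 1. With tolerance [1/8] the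
     first forces [f (g (act s y0)) < 1/4] and the second forces it above [3/4]. *)
  have cF (i : 'I_2) : continuous (if i == ord0 then f else fun y => f (g y)).
    by case: ifP => // _; exact: cont_comp.
  have e0 : 0 < 8^-1 :> R by rewrite invr_gt0.
  have [s sP] := zP 2 _ cF _ e0.
  have := sP ord0; have := sP ord_max; rewrite /= /state_act /nu -!eg.
  rewrite f0 f1 !ltr_norml => /andP[+ _] /andP[_].
  have /andP[] := f01 (act s y0); have /andP[] := f01 (g (act s y0)).
  have /andP[] := f01 (g (g (act s y0))); lra.
move=> y; apply: contrapT => /nesym/sep [f [cf _ f0 f1]].
suff /= : closure [set u | f (g u) = f u] y.
  have clf : closed [set u | f (g u) = f u].
    by apply: closed_eqfun => //; exact: cont_comp.
  by move=> /clf /=; rewrite f0 f1 => /eqP; rewrite oner_eq0.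
have sub : range (fun s => act s z) `<=` [set u | f (g u) = f u].
  by move=> _ [s _ <-] /=; rewrite eg gz.
by apply: (closure_subset sub); rewrite minY.
Qed.

Theorem theorem3p7 (R : realType) (G : groupType)
    (phi : (G -> CC R) -> (G -> CC R)) :
  minimal_G_projection phi ->
  (forall (B : topologicalType) (actB : G -> B -> B),
      G_boundary R actB ->
      equivariant_factor (Hamana_act phi) actB) /\
  (G_boundary R (Hamana_act phi) /\
   forall (F : topologicalType) (actF : G -> F -> F),
      Furstenberg_boundary R actF ->
      equivariant_homeomorphic (Hamana_act phi) actF).
Proof.
move=> [phiP phi_min].
have factor (B : topologicalType) (actB : G -> B -> B) : G_boundary R actB ->
    equivariant_factor (Hamana_act phi) actB.
  by move=> BP; have [[[b _] _ _ _] _ _] := BP; exact: boundary_factor BP b.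
have XP : G_boundary R (Hamana_act phi) by exact: Hamana_G_boundary.
do 2 split => //; move=> F actF [FP Funiv].
have [p [cp ep _]] := factor F actF FP.
have [q [cq eq _]] := Funiv _ _ XP.
(* Both composites are equivariant continuous self-maps of boundaries, hence identities. *)
exists p, q; split => //.
  apply: (boundary_endomorphism_id XP) => [|s x]; last by rewrite ep eq.
  exact: cont_comp cp cq.
apply: (boundary_endomorphism_id FP) => [|s x]; last by rewrite eq ep.
exact: cont_comp cq cp.
Qed.
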